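(* Let $\Sigma=\{c_1,\dots,c_\sigma\}$ be a finite alphabet, let $s\in\Sigma^n$ be a primitive string, and for every string $x$ over $\Sigma$ let $\pi_x$ be a total order of $\Sigma$. Suppose we are given $L=BWT_{*}(s)$ with constant-time rank support, the orderings $\pi_x$, and the index $i$ of the row of $M_{*}(s)$ equal to $s$. Then $s$ can be recovered in ${\cal O}(\sigma |s|^2)$ time and ${\cal O}(\sigma |s|)$ working space.
   Context: A string is primitive if all its $n$ cyclic rotations are distinct. The context adaptive BWT matrix $M_{*}(s)$ is the $n\times n$ matrix whose rows (numbered $1,\dots,n$ from top to bottom) are the cyclic rotations of $s$, sorted as follows: for two distinct rotations $u\neq v$, let $x$ be their longest common prefix ($|x|<n$) and let $a\neq b$ be the symbols following $x$ in $u$ and $v$ respectively; then $u$ precedes $v$ iff $a$ precedes $b$ in the order $\pi_x$. $BWT_{*}(s)$ is the last column $L$ of $M_{*}(s)$, read top to bottom. For $c\in\Sigma$, $\mathsf{rank}_c(L,j)$ is the number of occurrences of $c$ in $L[1,j]$; ''constant-time rank support'' means these queries are answered in ${\cal O}(1)$ time. Computational model: word RAM with word size $w$ and $\sigma=w^{{\cal O}(1)}$. *)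

(* Defs.v *)
From mathcomp Require Import all_boot.

Set Implicit Arguments.
Unset Strict Implicit.
Unset Printing Implicit Defensive.

Section ContextAdaptiveBWT.

Variable sigma : nat.

(* The alphabet {c_1, ..., c_sigma} is 'I_sigma; positions, rows and symbols
   are numbered from 0. *)
Notation symbol := 'I_sigma.
Notation string := (seq symbol).

Definition is_total_order (r : rel symbol) : Prop :=
  [/\ reflexive r, antisymmetric r, transitive r & total r].

Definition rotations (s : string) : seq string :=
  [seq rot k s | k <- iota 0 (size s)].

Definition primitive (s : string) : bool := uniq (rotations s).

Fixpoint lcp (u v : string) : string :=
  match u, v with
  | a :: u', b :: v' => if a == b then a :: lcp u' v' else [::]
  | _, _ => [::]
  end.

(* [pi x a b] reads "a = b or a precedes b in the order pi_x". *)
Definition precedes (pi : string -> rel symbol) (u v : string) : bool :=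
  let x := lcp u v in
  match onth u (size x), onth v (size x) with
  | Some a, Some b => pi x a b
  | _, _ => false
  end.

Definition ca_matrix (pi : string -> rel symbol) (s : string) : seq string :=
  sort (fun u v => (u == v) || precedes pi u v) (rotations s).

Definition last_column (M : seq string) : string :=
  pmap (fun row : string => onth row (size row).-1) M.

Definition ca_bwt (pi : string -> rel symbol) (s : string) : string :=
  last_column (ca_matrix pi s).

(* Occurrences of the symbol number c among the first j symbols of L. *)
Definition rank (L : string) (c j : nat) : nat :=
  count (fun a : symbol => val a == c) (take j L).

(* The symbols listed in increasing order for r. *)
Definition listing (r : rel symbol) : string := sort r (enum symbol).

End ContextAdaptiveBWT.

(* Word RAM. A program is a finite list of instructions acting on registers
   (finitely many occur in a program) and on a working memory addressed by
   words; words are the natural numbers below 2 ^ w. *)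

Inductive binop : Type :=
  | OAdd | OSub | OMul | ODiv | OMod | OAnd | OOr | OXor | OShl | OShr.

Definition eval_binop (w : nat) (o : binop) (a b : nat) : nat :=
  match o with
  | OAdd => (a + b) %% 2 ^ w
  | OSub => (a + (2 ^ w - b)) %% 2 ^ w
  | OMul => (a * b) %% 2 ^ w
  | ODiv => a %/ b
  | OMod => a %% b
  | OAnd => Nat.land a b
  | OOr => Nat.lor a b
  | OXor => Nat.lxor a b
  | OShl => (a * 2 ^ b) %% 2 ^ w
  | OShr => a %/ 2 ^ b
  end.

(* Operands are register numbers, except the immediate v of IConst and the
   jump targets, which are absolute positions in the program. The last three
   instructions are the only access to the input string L and to the
   orderings:
     ILast  d j      d := L[j]
     IRank  d c j    d := rank_c(L, j)
     IOrder d a l k  d := k-th symbol in the order pi_x, where x is the string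
                     of length l stored in memory from address a on. *)
Inductive instr : Type :=
  | IConst (d v : nat)
  | IOp (o : binop) (d a b : nat)
  | ILoad (d a : nat)
  | IStore (a b : nat)
  | IJump (t : nat)
  | IJumpLt (a b t : nat)
  | IJumpEq (a b t : nat)
  | ILast (d j : nat)
  | IRank (d c j : nat)
  | IOrder (d a l k : nat)
  | IHalt.

Definition program : Type := seq instr.

(* [time] is the cost of the run so far; [space] is one more than the largest
   memory address accessed so far (0 if there is none). *)
Record config : Type := Config {
  pc : nat;
  regs : nat -> nat;
  memory : nat -> nat;
  time : nat;
  space : nat }.

Definition update (f : nat -> nat) (a v : nat) : nat -> nat :=
  fun b => if b == a then v else f b.

Section Semantics.

Variables (w sigma : nat).
Variables (L : seq 'I_sigma) (pi : seq 'I_sigma -> rel 'I_sigma).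

Definition read_string (m : nat -> nat) (a l : nat) : option (seq 'I_sigma) :=
  let cells := [seq m t | t <- iota a l] in
  if all (fun v => v < sigma) cells then Some (pmap insub cells) else None.

Definition set_reg (c : config) (d v : nat) : config :=
  Config (pc c).+1 (update (regs c) d v) (memory c) (time c).+1 (space c).

Definition goto (c : config) (t : nat) : config :=
  Config t (regs c) (memory c) (time c).+1 (space c).

(* None: the program counter is out of range, the machine has halted, or an
   input query is ill-formed. Every instruction costs 1, except that querying
   pi_x costs |x| + 1. *)
Definition step (P : program) (c : config) : option config :=
  let R := regs c in
  match onth P (pc c) with
  | None | Some IHalt => None
  | Some (IConst d v) => Some (set_reg c d (v %% 2 ^ w))
  | Some (IOp o d a b) => Some (set_reg c d (eval_binop w o (R a) (R b)))
  | Some (ILoad d a) =>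
      Some (Config (pc c).+1 (update R d (memory c (R a))) (memory c)
                   (time c).+1 (maxn (space c) (R a).+1))
  | Some (IStore a b) =>
      Some (Config (pc c).+1 R (update (memory c) (R a) (R b))
                   (time c).+1 (maxn (space c) (R a).+1))
  | Some (IJump t) => Some (goto c t)
  | Some (IJumpLt a b t) => Some (goto c (if R a < R b then t else (pc c).+1))
  | Some (IJumpEq a b t) => Some (goto c (if R a == R b then t else (pc c).+1))
  | Some (ILast d j) => omap (fun a => set_reg c d (val a)) (onth L (R j))
  | Some (IRank d x j) =>
      if (R x < sigma) && (R j <= size L)
      then Some (set_reg c d (rank L (R x) (R j))) else None
  | Some (IOrder d a l k) =>
      if R a + R l <= 2 ^ w then
        obind (fun x =>
          omap (fun b => Config (pc c).+1 (update R d (val b)) (memory c)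
                                (time c + (R l).+1)
                                (maxn (space c) (R a + R l)))
               (onth (listing (pi x)) (R k)))
          (read_string (memory c) (R a) (R l))
      else None
  end.

Definition halted (P : program) (c : config) : Prop :=
  onth P (pc c) = Some IHalt.

(* Registers 0, 1, 2 hold the length of L, the alphabet size and the row
   index; all other registers and the working memory are zero. *)
Definition init (i : nat) : config :=
  Config 0 (nth 0 [:: size L; sigma; i]) (fun=> 0) 0 0.

Definition halts_with (P : program) (i : nat) (c : config) : Prop :=
  (exists t, iter t (obind (step P)) (Some (init i)) = Some c) /\ halted P c.

End Semantics.

(* Main.v *)
Require Import Defs.
From mathcomp Require Import all_boot.
From mathcomp Require Import zify.

(* Rows of the matrix M are refined column by column. At level m the machine
   keeps a permutation phi of the rows such that row phi(q), rotated so that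
   its last symbol comes first, agrees with row q on the first m symbols; at
   level 0 phi is the identity. The rows sharing their first m symbols y form a
   contiguous block, and both the block and its rotated phi-image list all the
   rotations of s that begin with y. Column m of the block is sorted by pi_y,
   so sorting the phi-image by its column m in the order pi_y makes phi agree on
   m + 1 symbols. Iterating phi from row q and reading L spells out the first m
   symbols of row q: this yields the context y passed to the order oracle, and
   at level n, from row i, the string s.

   Querying pi_y costs |y| + 1 per symbol, so it is done only for the blocks
   that do split. There are fewer than n splits over all the levels, hence the
   queries cost O(sigma n^2) in total, and the rest costs O(sigma n) per
   level. *)

Set Implicit Arguments.
Unset Strict Implicit.
Unset Printing Implicit Defensive.

(** * The context adaptive matrix *)

Section AdaptiveOrder.

Variable sigma : nat.
Implicit Types (pi : seq 'I_sigma -> rel 'I_sigma) (u v w : seq 'I_sigma).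

(** The relation by which [ca_matrix] sorts. [precedes] is false on equal strings, where no symbol
    follows the common prefix, hence the first disjunct. *)
Definition ca_le pi u v := (u == v) || precedes pi u v.

(** Removing a common first symbol shifts the family of orders to the contexts that begin with it;
    the inductions below therefore generalise over [pi]. *)
Lemma ca_le_cons pi a b u v :
  ca_le pi (a :: u) (b :: v) =
  if a == b then ca_le (fun x => pi (a :: x)) u v else pi [::] a b.
Proof.
rewrite /ca_le /precedes /= eqseq_cons.
by case: eqP => //= ->.
Qed.

Lemma ca_le_total pi u v :
  (forall x, is_total_order (pi x)) -> size u = size v ->
  ca_le pi u v || ca_le pi v u.
Proof.
elim: u v pi => [|a u IH] [|b v] pi //= tot_pi [size_uv].
rewrite !ca_le_cons eq_sym; case: eqP => [->|_].
  by apply: IH => // x; apply: tot_pi.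
by case: (tot_pi [::]) => _ _ _; apply.
Qed.

Lemma ca_le_trans pi v u w :
  (forall x, is_total_order (pi x)) -> size u = size v -> size v = size w ->
  ca_le pi u v -> ca_le pi v w -> ca_le pi u w.
Proof.
elim: v u w pi => [|b v IH] [|a u] [|c w] pi //= tot_pi [size_uv] [size_vw].
rewrite !ca_le_cons; case: (tot_pi [::]) => _ anti trans _.
case: (eqVneq a b) => [<-|neq_ab].
  by case: eqP => // _; apply: IH => // x; apply: tot_pi.
case: (eqVneq b c) => [<-|neq_bc] le_ab; first by rewrite (negPf neq_ab).
move=> le_bc; case: eqP => [eq_ac|_]; last exact: trans le_ab le_bc.
by case/eqP: neq_ab; apply: anti; rewrite le_ab eq_ac le_bc.
Qed.

(** Where [v] first left the common prefix, its symbol would lie both above and below the symbol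
    shared by [u] and [w], against antisymmetry. Rows with a common prefix are thus contiguous. *)
Lemma ca_le_convex pi m u v w :
  (forall x, is_total_order (pi x)) -> size u = size v -> size v = size w ->
  ca_le pi u v -> ca_le pi v w -> take m u = take m w -> take m u = take m v.
Proof.
elim: m u v w pi => [|m IH] u v w pi; first by rewrite !take0.
case: u v w => [|a u] [|b v] [|c w] //= tot_pi [size_uv] [size_vw].
rewrite !ca_le_cons => le_uv le_vw [eq_ac eq_uw]; subst c.
case: (tot_pi [::]) => _ anti _ _.
move: le_uv le_vw; case: (eqVneq a b) => [<-|neq_ab].
  move=> le_uv le_vw; congr (_ :: _).
  by apply: IH le_uv le_vw eq_uw => // x; apply: tot_pi.
move=> le_ab le_ba; case/eqP: neq_ab; apply: anti; by rewrite le_ab le_ba.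
Qed.

(** Either the symbols after the common prefix coincide, or they are the first difference and [pi]
    compares them in that very context. This sorts column [m] within a block. *)
Lemma ca_le_next pi c m u v :
  (forall x, is_total_order (pi x)) -> size u = size v -> m < size u ->
  ca_le pi u v -> take m u = take m v ->
  pi (take m u) (nth c u m) (nth c v m).
Proof.
elim: m u v pi => [|m IH] [|a u] [|b v] pi //= tot_pi [size_uv] ltm.
  rewrite ca_le_cons; case: eqP => [->|//].
  by case: (tot_pi [::]) => refl _ _ _ *; apply: refl.
rewrite ca_le_cons => le_uv [eq_ab eq_uv]; subst b; move: le_uv.
rewrite eqxx => le_uv.
by apply: (IH u v (fun x => pi (a :: x))) => // x; apply: tot_pi.
Qed.

End AdaptiveOrder.

(** Rotating right by one sends rotation k+1 to rotation k and rotation 0 to the last one, so it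
    only cycles the list. *)
Lemma perm_rotations_rotr sigma (s : seq 'I_sigma) :
  perm_eq [seq rotr 1 u | u <- rotations s] (rotations s).
Proof.
rewrite /rotations -map_comp.
case def_n: (size s) => [//|n].
have rotr_last : rotr 1 (rot 0 s) = rot n s by rewrite rot0 /rotr def_n subn1.
have rotr_pred k : k < n -> rotr 1 (rot k.+1 s) = rot k s.
  by move=> ltk; rewrite -(add1n k) rotD; [apply: rotK | lia].
rewrite [iota 0 n.+1]/= [X in perm_eq X _]/= rotr_last.
rewrite (_ : map _ (iota 1 n) = [seq rot k s | k <- iota 0 n]).
  rewrite -[0 :: iota 1 n]/(iota 0 n.+1) -addn1 iotaD map_cat /= add0n.
  by rewrite -cat1s perm_catC.
rewrite -[1]addn0 iotaDl -map_comp.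
by apply/eq_in_map => k; rewrite mem_iota => ltk /=; rewrite add1n rotr_pred.
Qed.

(** * Bucket sort by a list of keys *)

Section Buckets.

Variables (T K : eqType) (key : T -> K).

Definition buckets (l : seq K) (s : seq T) : seq T :=
  flatten [seq [seq x <- s | key x == a] | a <- l].

Lemma perm_buckets l s :
  uniq l -> {in s, forall x, key x \in l} -> perm_eq (buckets l s) s.
Proof.
elim: l s => [|a l IH] s /=.
  by case: s => // x s _ /(_ x (mem_head _ _)).
case/andP => a_l uniq_l key_s; rewrite /buckets /=.
rewrite perm_sym -(perm_filterC (fun x => key x == a) s) perm_cat2l perm_sym.
rewrite -/(buckets l s).
suff -> : buckets l s = buckets l [seq x <- s | key x != a].
  apply: IH => // x; rewrite mem_filter => /andP[neq_xa /key_s].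
  by rewrite inE (negPf neq_xa).
congr flatten; apply/eq_in_map => b b_l; rewrite -filter_predI.
apply: eq_filter => x /=; case: eqP => // ->.
by case: eqP => // eq_ba; rewrite -eq_ba b_l in a_l.
Qed.

(** Inside a bucket all keys are equal and reflexivity applies; across buckets the order is that of
    [l]. *)
Lemma sorted_buckets (r : rel K) l s :
  reflexive r -> transitive r -> sorted r l -> sorted r (map key (buckets l s)).
Proof.
move=> refl trans; rewrite !sorted_pairwise //.
have key_a a x : x \in map key [seq y <- s | key y == a] -> x = a.
  by case/mapP => y; rewrite mem_filter => /andP[/eqP <- _].
elim: l => //= a l IH /andP[le_al sorted_l].
rewrite /buckets /= map_cat pairwise_cat IH // andbT; apply/andP; split.
  apply/allrelP => x y /key_a -> /mapP[z /flattenP[_ /mapP[b b_l ->]]].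
  by rewrite mem_filter => /andP[/eqP -> _] ->; apply: (allP le_al).
apply/(pairwiseP a) => i j; rewrite !inE => lti ltj _.
by rewrite (key_a a _ (mem_nth _ lti)) (key_a a _ (mem_nth _ ltj)).
Qed.

End Buckets.

(** * Rows of the matrix and their blocks of common prefixes *)

Section Matrix.

Variables (sigma n : nat) (s : n.-tuple 'I_sigma).
Variables (pi : seq 'I_sigma -> rel 'I_sigma) (c0 : 'I_sigma).
Hypothesis tot_pi : forall x, is_total_order (pi x).
Hypothesis n_gt0 : 0 < n.

Let M := ca_matrix pi s.

Lemma perm_ca_matrix : perm_eq M (rotations s).
Proof. by rewrite /M /ca_matrix perm_sort. Qed.

Lemma size_ca_matrix : size M = n.
Proof. by rewrite (perm_size perm_ca_matrix) size_map size_iota size_tuple. Qed.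

Lemma size_row_mem u : u \in M -> size u = n.
Proof.
by rewrite (perm_mem perm_ca_matrix) => /mapP[j _ ->]; rewrite size_rot size_tuple.
Qed.

Definition row q := nth [::] M q.

Lemma size_row q : q < n -> size (row q) = n.
Proof. by move=> ltq; rewrite size_row_mem // mem_nth // size_ca_matrix. Qed.

Lemma row_le p q : p < q < n -> ca_le pi (row p) (row q).
Proof.
case/andP => ltpq ltq.
have sizeM: all (fun u => size u == n) M.
  by apply/allP => u /size_row_mem ->.
(* Totality and transitivity are established at equal length, so the sorting lemmas are used
   relative to [size u == n]. *)
have trans_M : {in fun u : seq _ => size u == n & &, transitive (ca_le pi)}.
  by move=> v u w /eqP sv /eqP su /eqP sw; apply: ca_le_trans; rewrite ?su ?sv.
have: pairwise (ca_le pi) M.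
  rewrite -(sorted_pairwise_in trans_M) //.
  apply: (@sort_sorted_in _ (fun u => size u == n)).
    by move=> u v /eqP su /eqP sv; apply: ca_le_total; rewrite ?su.
  by apply/allP => u; rewrite -(perm_mem perm_ca_matrix) => /(allP sizeM).
move/(pairwiseP [::]); apply; rewrite ?inE ?size_ca_matrix //.
exact: ltn_trans ltpq ltq.
Qed.

(* Column 0 of the rotated row is its last symbol, so [rsym q 0] is [L[q]]. *)
Definition sym q t : nat := nth c0 (row q) t.
Definition rsym q t : nat := nth c0 (rotr 1 (row q)) t.

(** Together with the agreement of phi, this makes one application of phi advance one symbol along a
    row. *)
Lemma rsymS q t : q < n -> t.+1 < n -> rsym q t.+1 = sym q t.
Proof.
move=> ltq ltt; rewrite /rsym /sym /rotr nth_cat size_drop size_row //.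
have -> : n - (n - 1) = 1 by lia.
by rewrite ltnS ltn0 subSS subn0 nth_take //; lia.
Qed.

Lemma rsym0 q : q < n -> rsym q 0 = sym q n.-1.
Proof.
move=> ltq; rewrite /rsym /sym /rotr nth_cat size_drop size_row //.
have -> : n - (n - 1) = 1 by lia.
by rewrite /= nth_drop addn0 subn1.
Qed.

Lemma size_ca_bwt : size (ca_bwt pi s) = n.
Proof.
rewrite /ca_bwt /last_column size_pmap -[RHS]size_ca_matrix.
rewrite -/M; apply/eqP; rewrite -all_count; apply/allP => u uM /=.
by rewrite onthE (nth_map c0) // (size_row_mem uM) prednK.
Qed.

Lemma onth_ca_bwt q :
  q < n -> exists2 a, onth (ca_bwt pi s) q = Some a & val a = rsym q 0.
Proof.
move=> ltq; exists (nth c0 (row q) n.-1); last by rewrite rsym0.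
have -> : ca_bwt pi s = [seq nth c0 u n.-1 | u <- M].
  rewrite /ca_bwt /last_column -/M; apply: (inj_map Some_inj).
  rewrite pmapS_filter -map_comp.
  (* Rows are nonempty, so [pmap] drops none of them and positions are preserved. *)
  rewrite (_ : filter _ M = M); last first.
    apply/all_filterP/allP => u uM /=.
    by rewrite onthE (nth_map c0) // (size_row_mem uM) prednK.
  apply/eq_in_map => u uM /=.
  by rewrite onthE (nth_map c0) (size_row_mem uM) // prednK.
by rewrite onthE (nth_map c0) ?(nth_map [::]) ?size_map ?size_ca_matrix.
Qed.

Definition prefix_eq m p q := take m (row p) == take m (row q).

Lemma prefix_eqP m p q : m <= n -> p < n -> q < n ->
  reflect (forall t, t < m -> sym p t = sym q t) (prefix_eq m p q).
Proof.
move=> lem ltp ltq; apply: (iffP eqP) => [eq_pq t ltt | eq_pq].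
  by rewrite /sym -(nth_take c0 ltt) eq_pq nth_take.
apply: (@eq_from_nth _ c0); rewrite !size_take_min !size_row //.
move=> t; rewrite leq_min => /andP[ltt _]; rewrite !nth_take //.
exact/val_inj/eq_pq.
Qed.

Lemma prefix_convex m p q r :
  p <= q <= r -> r < n -> prefix_eq m p r -> prefix_eq m p q.
Proof.
case/andP => lepq leqr ltr eq_pr.
case: (ltngtP p q) lepq => // [ltpq|<-] _; last exact/eqP.
case: (ltngtP q r) leqr => // [ltqr|->//] _.
have ltq := ltn_trans ltqr ltr; have ltp := ltn_trans ltpq ltq.
apply/eqP; apply: (@ca_le_convex _ pi m _ _ (row r)); rewrite ?size_row //.
- by apply: row_le; rewrite ltpq.
- by apply: row_le; rewrite ltqr.
- exact/eqP.
Qed.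

(* [starts m j]: row j opens a block of rows sharing their first m symbols;
   row n counts as the opening of a block past the end. *)
Definition starts m j := [|| j == 0, j == n | ~~ prefix_eq m j.-1 j].

Lemma prefix_eqS m p q : m < n -> p < n -> q < n ->
  prefix_eq m.+1 p q = prefix_eq m p q && (sym p m == sym q m).
Proof.
move=> ltm ltp ltq; rewrite /prefix_eq !(take_nth c0) ?size_row //.
by rewrite eqseq_rcons.
Qed.

(** The rule by which [mark_code] updates the marks; rows 0 and n are marked at every level. *)
Lemma startsS m j : m < n -> 0 < j < n ->
  starts m.+1 j = starts m j || (sym j.-1 m != sym j m).
Proof.
by move=> ltm inj; rewrite /starts prefix_eqS //; lia.
Qed.

Lemma starts_mono m j : m < n -> j <= n -> starts m j -> starts m.+1 j.
Proof.
move=> ltm lej; case: (posnP j) => [-> //|j_gt0].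
case: (eqVneq j n) => [->|ne_j]; first by rewrite /starts eqxx orbT.
by rewrite startsS //; [move=> -> | lia].
Qed.

Lemma starts0 j : starts 0 j = (j == 0) || (j == n).
Proof. by rewrite /starts /prefix_eq !take0 eqxx orbF. Qed.

Lemma starts_end m : starts m n.
Proof. by rewrite /starts eqxx orbT. Qed.

Definition block m lo hi :=
  forall j, j < n -> (lo <= j < hi) = prefix_eq m lo j.

(** Inside, equality of neighbours chains up from [lo]. Outside, a row with the same prefix would by
    convexity force equality across one of the two marked borders. *)
Lemma block_starts m lo hi :
  lo < hi -> hi <= n -> starts m lo -> starts m hi ->
  (forall j, lo < j < hi -> ~~ starts m j) -> block m lo hi.
Proof.
move=> lthi lehi st_lo st_hi inner.
have inb j : lo <= j < hi -> prefix_eq m lo j.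
  elim: j => [|j IH]; first by rewrite leqn0 => /andP[/eqP-> _]; apply: eqxx.
  case/andP; rewrite leq_eqVlt => /orP[/eqP-> _|lt_lo lt_hi]; first exact: eqxx.
  have /IH /eqP eq_lo : lo <= j < hi by lia.
  have /inner : lo < j.+1 < hi by lia.
  rewrite /starts !negb_or negbK => /and3P[_ _ /eqP eq_j].
  by rewrite /prefix_eq eq_lo eq_j.
move=> j ltj; apply/idP/idP => [/inb//|eq_j].
case: (ltnP j lo) => [lt_lo|ge_lo] /=.
  move: st_lo; rewrite /starts; case: eqP => [|_ /=]; first lia.
  case: eqP => [|_ /=]; first lia.
  rewrite /prefix_eq => /eqP[].
  have h : prefix_eq m j lo.-1.
    by apply: (@prefix_convex m j _ lo); rewrite 1?/prefix_eq 1?eq_sym //; lia.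
  by rewrite -(eqP h) (eqP eq_j).
case: ltnP => // ge_hi; move: st_hi; rewrite /starts; case: eqP => [|_ /=]; first lia.
case: eqP => [|_ /=]; first lia.
case/eqP; rewrite -(eqP (inb hi.-1 _)); last by lia.
by apply/eqP/(@prefix_convex m _ _ j) => //; lia.
Qed.

(** * Refining a permutation on one block *)

Section Refinement.

Variables (f : nat -> nat) (m lo hi : nat).
Hypothesis perm_f : perm_eq [seq f q | q <- iota 0 n] (iota 0 n).
Hypothesis agree_f : forall q t, q < n -> t < m -> rsym (f q) t = sym q t.
Hypotheses (ltm : m < n) (lthi : lo < hi) (lehi : hi <= n).
Hypothesis blk : block m lo hi.

Let f_lt q : q < n -> f q < n.
Proof.
move=> ltq; have := perm_mem perm_f (f q); rewrite mem_iota leq0n andTb add0n => <-.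
by apply: map_f; rewrite mem_iota.
Qed.

Let take_rsym q : q < n -> take m (rotr 1 (row (f q))) = take m (row q).
Proof.
move=> ltq; apply: (@eq_from_nth _ c0).
  by rewrite !size_take_min size_rotr !size_row ?f_lt.
move=> t; rewrite size_take_min leq_min => /andP[ltt _].
by rewrite !nth_take //; apply: val_inj; apply: agree_f.
Qed.

(* The rows of the block and their images under f, rotated, are two listings
   of all the rotations that begin with the common prefix of the block. *)
Lemma perm_block :
  perm_eq [seq rotr 1 (row (f q)) | q <- iota lo (hi - lo)]
          [seq row q | q <- iota lo (hi - lo)].
Proof.
have rowsE : M = [seq row q | q <- iota 0 n].
  by rewrite -size_ca_matrix map_nth_iota0 ?take_size.
have blockE : [seq q <- iota 0 n | take m (row q) == take m (row lo)]
              = iota lo (hi - lo).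
  have -> : n = lo + ((hi - lo) + (n - hi)) by lia.
  rewrite !iotaD add0n !filter_cat.
  rewrite (_ : filter _ (iota 0 lo) = [::]); last first.
    apply/eqP; rewrite -size_eq0 size_filter eqn0Ngt -has_count.
    apply/hasPn => q; rewrite mem_iota => ltq.
    by rewrite eq_sym -/(prefix_eq m lo q) -blk; lia.
  rewrite (_ : filter _ (iota (lo + (hi - lo)) _) = [::]); last first.
    apply/eqP; rewrite -size_eq0 size_filter eqn0Ngt -has_count.
    apply/hasPn => q; rewrite mem_iota => ltq.
    by rewrite eq_sym -/(prefix_eq m lo q) -blk; lia.
  rewrite cats0 /=; apply/all_filterP/allP => q; rewrite mem_iota => ltq.
  by rewrite eq_sym -/(prefix_eq m lo q) -blk; lia.
have: perm_eq [seq rotr 1 (row (f q)) | q <- iota 0 n] M.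
  rewrite (map_comp (fun q => rotr 1 (row q)) f).
  apply: perm_trans (perm_map _ perm_f) _.
  rewrite (map_comp (rotr 1) row) -rowsE.
  apply: perm_trans (perm_map _ perm_ca_matrix) _.
  by apply: perm_trans (perm_rotations_rotr s) _; rewrite perm_sym perm_ca_matrix.
(* Both listings of all the rotations are cut down to the common prefix; the rotated row [f q]
   passes exactly when row [q] does, since they agree on [m] symbols. *)
move/(perm_filter (fun u => take m u == take m (row lo))).
rewrite rowsE !filter_map /= blockE.
rewrite (_ : filter _ (iota 0 n) = iota lo (hi - lo)) // -blockE.
by apply: eq_in_filter => q; rewrite mem_iota => ltq /=; rewrite take_rsym.
Qed.

Let seg := [seq f q | q <- iota lo (hi - lo)].
Let key q := nth c0 (rotr 1 (row q)) m.
(** Keys are numbers here, as the machine sees them; [sorted_blockE] goes back to symbols, on which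
    the orders act. *)
Definition sorted_block :=
  buckets (fun q => rsym q m)
    [seq val a | a <- listing (pi (take m (row lo)))] seg.

Let sorted_blockE :
  sorted_block = buckets key (listing (pi (take m (row lo)))) seg.
Proof. by rewrite /sorted_block /buckets -map_comp. Qed.

Let uniq_listing : uniq (listing (pi (take m (row lo)))).
Proof. by rewrite sort_uniq enum_uniq. Qed.

Lemma perm_sorted_block : perm_eq sorted_block seg.
Proof.
by rewrite sorted_blockE perm_buckets // => x _; rewrite mem_sort mem_enum.
Qed.

Lemma size_sorted_block : size sorted_block = hi - lo.
Proof. by rewrite (perm_size perm_sorted_block) size_map size_iota. Qed.

(** Both columns are sorted by the order of the block and are permutations of each other, so
    antisymmetry makes them equal. *)
Let keys_sorted_block :
  map key sorted_block = [seq nth c0 (row q) m | q <- iota lo (hi - lo)].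
Proof.
have [refl anti trans tot] := tot_pi (take m (row lo)).
apply: (sorted_eq trans anti).
- by rewrite sorted_blockE; apply: sorted_buckets => //; apply: sort_sorted.
- rewrite sorted_pairwise //; apply/(pairwiseP c0) => p q.
  rewrite !inE size_map size_iota => ltp ltq ltpq.
  rewrite !(nth_map 0) ?size_iota // !nth_iota //.
  have eq_lo r : r < hi - lo -> take m (row lo) = take m (row (lo + r)).
    by move=> ltr; apply/eqP; rewrite -/(prefix_eq m lo _) -blk; lia.
  rewrite (eq_lo p) //; apply: ca_le_next; rewrite ?size_row //; try lia.
    by apply: row_le; lia.
  by rewrite -!eq_lo.
- apply: perm_trans (perm_map _ perm_sorted_block) _.
  have := perm_map (fun u => nth c0 u m) perm_block.
  by rewrite -!map_comp.
Qed.

(** Column [m] is settled by the sorted keys. On the columns before it all rows of the block look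
    alike, so reordering the images within the block does no harm. *)
Lemma sorted_block_agree q t :
  lo <= q < hi -> t <= m -> rsym (nth 0 sorted_block (q - lo)) t = sym q t.
Proof.
move=> inq; have ltq : q - lo < hi - lo by lia.
rewrite leq_eqVlt => /orP[/eqP->|ltt].
  have /(congr1 (fun l => nth c0 l (q - lo))) := keys_sorted_block.
  rewrite !(nth_map 0) ?size_sorted_block ?size_iota // nth_iota // subnKC; last by lia.
  by rewrite /rsym /sym => <-.
have : nth 0 sorted_block (q - lo) \in seg.
  by rewrite -(perm_mem perm_sorted_block) mem_nth ?size_sorted_block.
case/mapP => p; rewrite mem_iota => inp ->.
have /eqP eqpq : prefix_eq m p q.
  have /eqP ep : prefix_eq m lo p by rewrite -blk; lia.
  have /eqP eq : prefix_eq m lo q by rewrite -blk; lia.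
  by rewrite /prefix_eq -ep -eq.
rewrite agree_f; [| lia | by []].
by rewrite /sym -(nth_take c0 ltt) eqpq nth_take.
Qed.

Lemma perm_keys :
  perm_eq [seq rsym (f q) m | q <- iota lo (hi - lo)]
          [seq sym q m | q <- iota lo (hi - lo)].
Proof.
have := perm_map (fun u => nth c0 u m : nat) perm_block.
by rewrite -!map_comp.
Qed.

Let varies := has (fun q => rsym (f q) m != rsym (f lo) m) (iota lo (hi - lo)).

(** A constant list has only itself as a permutation, so column [m] of the block is the same
    constant and [f] can be kept without querying the order. *)
Lemma constant_block_agree q :
  ~~ varies -> lo <= q < hi -> rsym (f q) m = sym q m.
Proof.
move/hasPn => const inq.
have cst p : lo <= p < hi -> rsym (f p) m = rsym (f lo) m.
  by move=> inp; apply/eqP; rewrite -[_ == _]negbK const // mem_iota; lia.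
have : sym q m \in [seq rsym (f q) m | q <- iota lo (hi - lo)].
  rewrite (perm_mem perm_keys); apply: (map_f (sym^~ m)).
  by rewrite mem_iota; lia.
by case/mapP => p; rewrite mem_iota => inp ->; rewrite !cst //; lia.
Qed.

(** Were there no new opening inside the block, its column [m] would be constant, and by [perm_keys]
    the keys as well. So a block that has to be sorted does split, which bounds the number of
    queries. *)
Lemma varying_block_starts : varies -> exists2 j, lo < j < hi & starts m.+1 j.
Proof.
move=> var.
case E: (has (fun j => (lo < j) && starts m.+1 j) (iota lo (hi - lo))).
  case/hasP: E => j; rewrite mem_iota => inj /andP[ltj stj].
  by exists j => //; lia.
have {}E j : lo < j < hi -> ~~ starts m.+1 j.
  move=> inj; apply/negP => stj; move/hasPn: E => /(_ j).
  by rewrite mem_iota stj andbT => /(_ _); lia.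
have cst j : lo <= j < hi -> sym j m = sym lo m.
  elim: j => [|j IH]; first by rewrite leqn0 => /andP[/eqP->].
  case/andP; rewrite leq_eqVlt => /orP[/eqP-> //|ltj lthj].
  rewrite -IH; last by lia.
  have /E : lo < j.+1 < hi by lia.
  rewrite /starts !negb_or negbK => /and3P[_ _ /prefix_eqP-> //]; lia.
case/hasP: var => j; rewrite mem_iota => inj.
have key_lo p : lo <= p < hi -> rsym (f p) m = sym lo m.
  move=> inp; have : rsym (f p) m \in [seq sym q m | q <- iota lo (hi - lo)].
    rewrite -(perm_mem perm_keys); apply: (map_f (fun q => rsym (f q) m)).
    by rewrite mem_iota; lia.
  by case/mapP => q; rewrite mem_iota => inq ->; rewrite cst //; lia.
by rewrite !key_lo ?eqxx //; lia.
Qed.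

Definition refined q := if lo <= q < hi then nth 0 sorted_block (q - lo) else f q.

Lemma perm_refined : perm_eq [seq refined q | q <- iota 0 n] (iota 0 n).
Proof.
apply: perm_trans perm_f.
have -> : n = lo + ((hi - lo) + (n - hi)) by lia.
rewrite !iotaD add0n !map_cat.
rewrite (_ : map refined (iota lo _) = sorted_block); last first.
  apply: (@eq_from_nth _ 0); rewrite size_map size_iota ?size_sorted_block //.
  move=> q ltq; rewrite (nth_map 0) ?size_iota // nth_iota // /refined.
  by rewrite ifT; [congr nth; lia | lia].
rewrite (_ : map refined (iota 0 lo) = map f (iota 0 lo)); last first.
  by apply/eq_in_map => q; rewrite mem_iota /refined => ltq; rewrite ifF //; lia.
rewrite (_ : map refined (iota (lo + _) _)
             = map f (iota (lo + (hi - lo)) (n - hi))); last first.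
  by apply/eq_in_map => q; rewrite mem_iota /refined => ltq; rewrite ifF //; lia.
by rewrite perm_cat2l perm_cat2r perm_sorted_block.
Qed.

End Refinement.

End Matrix.

(** * Structured programs on the word RAM *)

Inductive cmd : Type :=
  | Do of instr
  | Then of cmd & cmd
  | WhileLt of nat & nat & cmd
  | IfEq of nat & nat & cmd
  | IfNe of nat & nat & cmd.

Local Notation "c ;; d" := (Then c d) (at level 60, right associativity).

(** Jump targets are absolute, hence the argument [off], the position where the code will lie. The
    guards of [WhileLt] and [IfEq] jump over an exit jump. *)
Fixpoint code (off : nat) (c : cmd) : program :=
  match c with
  | Do x => [:: x]
  | c1 ;; c2 => code off c1 ++ code (off + size (code off c1)) c2
  | WhileLt a b c =>
      let p := code off.+2 c in
      IJumpLt a b off.+2 :: IJump (off + size p).+3 :: rcons p (IJump off)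
  | IfEq a b c =>
      let p := code off.+2 c in
      IJumpEq a b off.+2 :: IJump (off + size p).+2 :: p
  | IfNe a b c =>
      let p := code off.+1 c in IJumpEq a b (off + size p).+1 :: p
  end.

(** Only the portion of [P] that starts at [off] is constrained, so fragments compose inside any
    larger program. *)
Definition placed (P : program) off (p : program) :=
  forall k, k < size p -> onth P (off + k) = onth p k.

Lemma placed_head P off x p : placed P off (x :: p) -> onth P off = Some x.
Proof. by move/(_ 0 isT); rewrite addn0. Qed.

Lemma placed_behead P off x p : placed P off (x :: p) -> placed P off.+1 p.
Proof. by move=> pl k ltk; rewrite addSnnS pl. Qed.

Lemma placed_catl P off p q : placed P off (p ++ q) -> placed P off p.
Proof.
move=> pl k ltk; rewrite pl ?size_cat ?ltn_addr //.
by rewrite !onthE map_cat nth_cat size_map ltk.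
Qed.

Lemma placed_catr P off p q :
  placed P off (p ++ q) -> placed P (off + size p) q.
Proof.
move=> pl k ltk; rewrite -addnA pl ?size_cat ?ltn_add2l //.
by rewrite !onthE map_cat nth_cat size_map ltnNge leq_addr addKn.
Qed.

(* [setr] is [update] in a form that computes on numerals. *)
Definition setr (R : nat -> nat) d v x := if eqn x d then v else R x.
Arguments setr R d v x /.

(** A configuration without its program counter, which structured code determines. *)
Record state : Type := State {
  reg : nat -> nat;
  cells : nat -> nat;
  tm : nat;
  sp : nat }.

Definition at_pc p st := Config p (reg st) (cells st) (tm st) (sp st).
Definition tick st := State (reg st) (cells st) (tm st).+1 (sp st).

(** * Weakest preconditions with time and space *)

Section Logic.

Variables (w sigma : nat) (L : seq 'I_sigma).
Variable pi : seq 'I_sigma -> rel 'I_sigma.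

Definition reaches P c c' :=
  exists t, iter t (obind (step w L pi P)) (Some c) = Some c'.

Lemma step_jump P c t :
  onth P (pc c) = Some (IJump t) -> step w L pi P c = Some (goto c t).
Proof. by rewrite /step => ->. Qed.

Lemma reaches_trans P c2 c1 c3 :
  reaches P c1 c2 -> reaches P c2 c3 -> reaches P c1 c3.
Proof. by move=> [t eq_t] [u eq_u]; exists (u + t); rewrite iterD eq_t. Qed.

Lemma reaches_step P c1 c2 : step w L pi P c1 = Some c2 -> reaches P c1 c2.
Proof. by exists 1. Qed.

(** Total correctness, wherever the code is placed: the run reaches the position just after it. Time
    and space belong to the state, so [Q] bounds the costs too. *)
Definition wp (c : cmd) (Q : state -> Prop) (st : state) : Prop :=
  forall P off, placed P off (code off c) ->
    exists2 st', reaches P (at_pc off st) (at_pc (off + size (code off c)) st')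
               & Q st'.

Lemma wp_then c1 c2 Q st : wp c1 (wp c2 Q) st -> wp (c1 ;; c2) Q st.
Proof.
move=> h P off /= pl.
have [st1 r1 /(_ _ _ (placed_catr pl)) [st2 r2 q2]] := h P off (placed_catl pl).
by exists st2 => //; rewrite size_cat addnA; apply: reaches_trans r1 r2.
Qed.

(** The index of the invariant is also the variant: it strictly increases and stays at most [N]. It
    may skip values, as in the loop that moves from block to block. Each [tick] counts a jump. *)
Lemma wp_while a b c (I : nat -> state -> Prop) N (Q : state -> Prop) j st :
  I j st ->
  (forall k st1, I k st1 -> reg st1 a < reg st1 b ->
     wp c (fun st2 => exists2 k', k < k' <= N & I k' (tick st2)) (tick st1)) ->
  (forall k st1, I k st1 -> reg st1 b <= reg st1 a -> Q (tick (tick st1))) ->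
  wp (WhileLt a b c) Q st.
Proof.
move=> I_st body exit P off /=; set p := code off.+2 c => pl.
have [d] := ubnP (N.+1 - j); elim: d => // d IH in j st I_st *.
rewrite ltnS => le_d.
have at0 := placed_head pl; have at1 := placed_head (placed_behead pl).
have pl2 := placed_behead (placed_behead pl); rewrite -cats1 in pl2.
have at3 := placed_head (placed_catr pl2).
case: (ltnP (reg st a) (reg st b)) => [lt_ab|le_ba].
  have [st2 r2 [k' /andP[ltk lek] I2]] := body _ _ I_st lt_ab _ _ (placed_catl pl2).
  have [|st3 r3 q3] := IH k' _ I2; first by lia.
  exists st3 => //; apply: reaches_trans r3.
  apply: reaches_trans (_ : reaches P _ (at_pc off.+2 (tick st))) _.
    by apply: reaches_step; rewrite /step /= at0 /goto /= lt_ab.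
  apply: reaches_trans r2 _; apply: reaches_step.
  exact: (@step_jump P (at_pc (off.+2 + size p) st2) off at3).
exists (tick (tick st)); last exact: exit I_st le_ba.
apply: reaches_trans (_ : reaches P _ (at_pc off.+1 (tick st))) _.
  by apply: reaches_step; rewrite /step /= at0 /goto /= ltnNge le_ba.
apply: reaches_step; rewrite (@step_jump P (at_pc off.+1 (tick st)) _ at1) /goto /=.
by congr (Some (Config _ _ _ _ _)); rewrite size_rcons; lia.
Qed.

Lemma wp_ifeq a b c (Q : state -> Prop) st :
  (reg st a = reg st b -> wp c Q (tick st)) ->
  (reg st a <> reg st b -> Q (tick (tick st))) -> wp (IfEq a b c) Q st.
Proof.
move=> h_eq h_ne P off /= pl.
have at0 := placed_head pl; have at1 := placed_head (placed_behead pl).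
have pl2 := placed_behead (placed_behead pl).
case: (eqVneq (reg st a) (reg st b)) => [eq_ab|ne_ab].
  have [st2 r2 q2] := h_eq eq_ab _ _ pl2; exists st2 => //=.
  rewrite -!addSnnS; apply: reaches_trans r2; apply: reaches_step.
  by rewrite /step /= at0 /goto /= eq_ab eqxx.
exists (tick (tick st)); last exact/h_ne/eqP.
apply: reaches_trans (_ : reaches P _ (at_pc off.+1 (tick st))) _.
  by apply: reaches_step; rewrite /step /= at0 /goto /= (negPf ne_ab).
apply: reaches_step; rewrite (@step_jump P (at_pc off.+1 (tick st)) _ at1) /goto /=.
by congr (Some (Config _ _ _ _ _)); lia.
Qed.

Lemma wp_ifne a b c (Q : state -> Prop) st :
  (reg st a <> reg st b -> wp c Q (tick st)) ->
  (reg st a = reg st b -> Q (tick st)) -> wp (IfNe a b c) Q st.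
Proof.
move=> h_ne h_eq P off /= pl.
have at0 := placed_head pl; have pl1 := placed_behead pl.
case: (eqVneq (reg st a) (reg st b)) => [eq_ab|ne_ab].
  exists (tick st); last exact: h_eq.
  by apply: reaches_step; rewrite /step /= at0 /goto /= eq_ab eqxx addnS.
have [st2 r2 q2] := h_ne (elimN eqP ne_ab) _ _ pl1; exists st2 => //=.
rewrite -addSnnS; apply: reaches_trans r2; apply: reaches_step.
by rewrite /step /= at0 /goto /= (negPf ne_ab).
Qed.

Lemma wp_do x (Q : state -> Prop) st st' :
  (forall P p, onth P p = Some x ->
     step w L pi P (at_pc p st) = Some (at_pc p.+1 st')) ->
  Q st' -> wp (Do x) Q st.
Proof.
move=> h q P off /placed_head at0; exists st' => //.
by rewrite addn1; apply/reaches_step/h.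
Qed.

Lemma wp_const d v (Q : state -> Prop) st : v < 2 ^ w ->
  Q (State (setr (reg st) d v) (cells st) (tm st).+1 (sp st)) ->
  wp (Do (IConst d v)) Q st.
Proof. by move=> ltv; apply: wp_do => P p at_p; rewrite /step /= at_p modn_small. Qed.

Lemma wp_add d a b (Q : state -> Prop) st : reg st a + reg st b < 2 ^ w ->
  Q (State (setr (reg st) d (reg st a + reg st b)) (cells st) (tm st).+1 (sp st)) ->
  wp (Do (IOp OAdd d a b)) Q st.
Proof. by move=> lt; apply: wp_do => P p at_p; rewrite /step /= at_p /= modn_small. Qed.

Lemma wp_load d a (Q : state -> Prop) st :
  Q (State (setr (reg st) d (cells st (reg st a))) (cells st) (tm st).+1
           (maxn (sp st) (reg st a).+1)) ->
  wp (Do (ILoad d a)) Q st.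
Proof. by apply: wp_do => P p at_p; rewrite /step /= at_p. Qed.

Lemma wp_store a b (Q : state -> Prop) st :
  Q (State (reg st) (update (cells st) (reg st a) (reg st b)) (tm st).+1
           (maxn (sp st) (reg st a).+1)) ->
  wp (Do (IStore a b)) Q st.
Proof. by apply: wp_do => P p at_p; rewrite /step /= at_p. Qed.

Lemma wp_last d j a (Q : state -> Prop) st :
  onth L (reg st j) = Some a ->
  Q (State (setr (reg st) d (val a)) (cells st) (tm st).+1 (sp st)) ->
  wp (Do (ILast d j)) Q st.
Proof. by move=> La; apply: wp_do => P p at_p; rewrite /step /= at_p /= La. Qed.

Lemma wp_order d a l k x b (Q : state -> Prop) st :
  reg st a + reg st l <= 2 ^ w ->
  read_string sigma (cells st) (reg st a) (reg st l) = Some x ->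
  onth (listing (pi x)) (reg st k) = Some b ->
  Q (State (setr (reg st) d (val b)) (cells st) (tm st + (reg st l).+1)
           (maxn (sp st) (reg st a + reg st l))) ->
  wp (Do (IOrder d a l k)) Q st.
Proof.
move=> le_w read_x list_b; apply: wp_do => P p at_p.
by rewrite /step /= at_p le_w read_x /= list_b.
Qed.

End Logic.

(** * The inversion program *)

Local Notation add d a b := (Do (IOp OAdd d a b)).

(* Registers 0-8 hold n, sigma, i, 1, n, 2n, 3n, 4n, 0 throughout: register 4
   is the base address of the array phi, 5 of the scratch array T, 6 of the
   symbols E, 7 of the block marks D; addresses 0 .. n-1 hold the extracted
   string. Then 9 is an address, 10 the level m, 11 and 12 the bounds of the
   current block, 13 the index in the listing, 14 the output position, 15 a
   loop counter, 16 and 17 values, 18 the branching mark. *)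

(** Register [b] holds the number of symbols to write. phi is applied before L is read, because L at
    phi(q) is the first symbol of row q. *)
Definition extract_code b :=
  Do (IConst 15 0) ;;
  WhileLt 15 b (
    add 9 4 16 ;; Do (ILoad 16 9) ;; Do (ILast 17 16) ;;
    Do (IStore 15 17) ;; add 15 15 3).

(** Walks to the next mark and records in register 18 whether some key differs from the first one of
    the block. As register 8 is zero, [add d a 8] is a copy. *)
Definition scan_code :=
  add 12 11 3 ;; Do (IConst 18 0) ;;
  add 9 4 11 ;; Do (ILoad 16 9) ;; add 9 6 16 ;; Do (ILoad 17 9) ;;
  add 9 7 12 ;; Do (ILoad 16 9) ;;
  WhileLt 16 3 (
    add 9 4 12 ;; Do (ILoad 16 9) ;; add 9 6 16 ;; Do (ILoad 16 9) ;;
    IfNe 16 17 (add 18 3 8) ;;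
    add 12 12 3 ;; add 9 7 12 ;; Do (ILoad 16 9)).

(** One pass over the block for the symbol in register 17. The output goes to T, since later passes
    still read phi. *)
Definition bucket_code :=
  add 15 11 8 ;;
  WhileLt 15 12 (
    add 9 4 15 ;; Do (ILoad 16 9) ;; add 9 6 16 ;; Do (ILoad 9 9) ;;
    IfEq 9 17 (add 9 5 14 ;; Do (IStore 9 16) ;; add 14 14 3) ;;
    add 15 15 3).

Definition sort_code :=
  add 14 11 8 ;; Do (IConst 13 0) ;;
  WhileLt 13 1 (Do (IOrder 17 8 10 13) ;; bucket_code ;; add 13 13 3).

Definition copy_code :=
  add 15 11 8 ;;
  WhileLt 15 12 (
    add 9 5 15 ;; Do (ILoad 16 9) ;; add 9 4 15 ;; Do (IStore 9 16) ;;
    add 15 15 3).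

Definition branch_code :=
  add 16 11 8 ;; extract_code 10 ;; sort_code ;; copy_code.

Definition blocks_code :=
  Do (IConst 11 0) ;;
  WhileLt 11 0 (scan_code ;; IfNe 18 8 branch_code ;; add 11 12 8).

(** Permutes E by phi, into T because E is read out of order. *)
Definition shift_code :=
  Do (IConst 15 0) ;;
  WhileLt 15 0 (
    add 9 4 15 ;; Do (ILoad 16 9) ;; add 9 6 16 ;; Do (ILoad 16 9) ;;
    add 9 5 15 ;; Do (IStore 9 16) ;; add 15 15 3).

(* In the last round register 17 receives a cell of E, not of T; the outcome
   of the comparison is then irrelevant since mark n is already set. *)
Definition mark_code :=
  Do (IConst 15 0) ;;
  WhileLt 15 0 (
    add 9 5 15 ;; Do (ILoad 16 9) ;; add 9 6 15 ;; Do (IStore 9 16) ;;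
    add 15 15 3 ;;
    add 9 5 15 ;; Do (ILoad 17 9) ;;
    IfNe 16 17 (add 9 7 15 ;; Do (IStore 9 3))).

Definition levels_code :=
  WhileLt 10 0 (blocks_code ;; shift_code ;; mark_code ;; add 10 10 3).

(** Sets up level 0: phi is the identity, E is L, and rows 0 and n are marked. The loop counter,
    register 15, is zero from the start. *)
Definition init_code :=
  Do (IConst 3 1) ;; add 4 0 8 ;; add 5 4 0 ;; add 6 5 0 ;; add 7 6 0 ;;
  WhileLt 15 0 (
    add 9 4 15 ;; Do (IStore 9 15) ;; Do (ILast 16 15) ;;
    add 9 6 15 ;; Do (IStore 9 16) ;; add 15 15 3) ;;
  Do (IStore 7 3) ;; add 9 7 0 ;; Do (IStore 9 3).

Definition invert_code :=
  init_code ;; levels_code ;; add 16 2 8 ;; extract_code 0.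

(** Frame condition: [l] lists the registers that may have changed. *)
Definition same (l : seq nat) (R R' : nat -> nat) :=
  forall x, x \notin l -> R' x = R x.

Lemma same_setr l R R' d v : d \in l -> same l R R' -> same l R (setr R' d v).
Proof.
move=> d_l sR x x_l; rewrite /setr -[eqn x d]/(x == d).
by case: eqP => [eq_xd|_]; [rewrite eq_xd d_l in x_l | apply: sR].
Qed.

Lemma same_trans l R1 R2 R3 l' :
  {subset l <= l'} -> same l R1 R2 -> same l' R2 R3 -> same l' R1 R3.
Proof.
move=> sub s12 s23 x x_l'; rewrite s23 // s12 //.
by apply: contra x_l' => /sub.
Qed.

Lemma update_same f a v : update f a v a = v.
Proof. by rewrite /update eqxx. Qed.

Lemma update_other f a v b : b <> a -> update f a v b = f b.
Proof. by move=> /eqP ne; rewrite /update (negPf ne). Qed.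

(** * Specifications of the pieces of the program *)

Section Correctness.

Variables (w sigma n : nat) (s : n.-tuple 'I_sigma).
Variables (pi : seq 'I_sigma -> rel 'I_sigma) (i : nat) (c0 : 'I_sigma).
Hypothesis tot_pi : forall x, is_total_order (pi x).
Hypothesis n_gt0 : 0 < n.
Hypothesis w_big : 10 * n + sigma < 2 ^ w.

Local Notation wp := (wp w (ca_bwt pi s) pi).
Local Notation sym := (sym s pi c0).
Local Notation rsym := (rsym s pi c0).

Definition consts (R : nat -> nat) :=
  forall x, x < 9 ->
    R x = nth 0 [:: n; sigma; i; 1; n; 2 * n; 3 * n; 4 * n; 0] x.

Lemma consts_same R R' l :
  all (fun x => 9 <= x) l -> same l R R' -> consts R -> consts R'.
Proof.
move=> /allP l_big sR cR x ltx; rewrite sR ?cR //.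
by apply/negP => /l_big; rewrite leqNgt ltx.
Qed.

Lemma constsE R : consts R ->
  (R 0 = n) * (R 1 = sigma) * (R 2 = i) * (R 3 = 1) * (R 4 = n) *
  (R 5 = 2 * n) * (R 6 = 3 * n) * (R 7 = 4 * n) * (R 8 = 0).
Proof. by move=> c; rewrite !c. Qed.

(** Specifications are in continuation form: the last premise lists what [Q] may rely on. After [j]
    rounds the current row begins with what remains to be written of row [q0]; [rsymS] carries this
    over one application of phi. *)
Lemma extract_spec (b m q0 : nat) (Q : state -> Prop) st :
  consts (reg st) -> b \notin [:: 9; 15; 16; 17] ->
  reg st b = m -> m <= n -> reg st 16 = q0 -> q0 < n ->
  (forall q, q < n -> cells st (n + q) < n) ->
  (forall q t, q < n -> t < m -> rsym (cells st (n + q)) t = sym q t) ->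
  sp st <= 5 * n + 1 ->
  (forall R mm t p,
     same [:: 9; 15; 16; 17] (reg st) R ->
     (forall x, x < m -> mm x = sym q0 x) ->
     (forall x, m <= x -> mm x = cells st x) ->
     t <= tm st + 7 * m + 3 -> p <= 5 * n + 1 -> Q (State R mm t p)) ->
  wp (extract_code b) Q st.
Proof.
case: st => R0 mm0 t0 p0 /= cR b_l Rb lem R16 ltq0 lt_phi agr le_p post.
apply: wp_then; apply: wp_const => /=; first by lia.
apply: (@wp_while _ _ _ _ _ _ _ (fun j st =>
  [/\ reg st 15 = j, j <= m, same [:: 9; 15; 16; 17] R0 (reg st),
      exists q, [/\ reg st 16 = q, q < n
        & forall t, j + t < m -> sym q t = sym q0 (j + t)]
    & [/\ forall x, x < j -> cells st x = sym q0 x,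
          forall x, m <= x -> cells st x = mm0 x,
          tm st <= t0 + 1 + 7 * j & sp st <= 5 * n + 1]]) n _ 0).
- split=> //=.
  + by do 2?apply: same_setr.
  + by exists q0.
  + by split=> //; lia.
- move=> j [R mm t p] /= [R15 lej sR [q [R16' ltq agq]] [mlo mhi let_ lep]].
  rewrite (sR b) // Rb R15 => ltj.
  have cR' := constsE (consts_same (l := [:: 9; 15; 16; 17]) isT sR cR).
  apply: wp_then; apply: wp_add => /=; rewrite !cR' R16'; first by lia.
  apply: wp_then; apply: wp_load => /=.
  (* phi lies from address [n] on, out of reach of the output, which stays below [m <= n]. *)
  have nq : mm (n + q) = mm0 (n + q) by apply: mhi; lia.
  have [|a La aE] := @onth_ca_bwt sigma n s pi c0 n_gt0 (mm (n + q)).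
    by rewrite nq lt_phi.
  apply: wp_then; apply: wp_last => /=; [exact: La | rewrite {}aE].
  apply: wp_then; apply: wp_store => /=.
  apply: wp_add => /=; rewrite !cR' R15; first by lia.
  exists j.+1; first by lia.
  split=> /=; [lia | lia | by do 4?apply: same_setr | | ].
  + exists (mm (n + q)); split=> //; first by rewrite nq lt_phi.
    move=> x ltx; have -> : j.+1 + x = j + x.+1 by lia.
    rewrite -agq; last by lia.
    rewrite -(agr q x.+1) //; last by lia.
    by rewrite -nq rsymS //; [rewrite nq lt_phi | lia].
  + split=> //; [ | | lia | lia].
    * move=> x; rewrite ltnS leq_eqVlt => /orP[/eqP->|ltx].
        rewrite update_same nq agr //; last by lia.
        by rewrite agq ?addn0.
      by rewrite update_other; [apply: mlo | lia].
    * by move=> x lex; rewrite update_other; [apply: mhi | lia].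
- move=> j [R mm t p] /= [R15 lej sR [q [R16' ltq agq]] [mlo mhi let_ lep]].
  rewrite (sR b) // Rb R15 => lemj; have eq_jm : j = m by lia.
  rewrite eq_jm in mlo let_.
  by apply: post; [exact: sR | exact: mlo | exact: mhi | rewrite /=; lia | exact: lep].
Qed.

Local Notation starts := (starts s pi).

Lemma scan_spec (m lo : nat) (Q : state -> Prop) st :
  consts (reg st) -> reg st 11 = lo -> lo < n ->
  (forall q, q < n -> cells st (n + q) < n) ->
  (forall t, t <= n -> cells st (4 * n + t) = starts m t) ->
  sp st <= 5 * n + 1 ->
  (forall R hi t p,
     same [:: 9; 12; 16; 17; 18] (reg st) R ->
     R 12 = hi -> lo < hi -> hi <= n -> starts m hi ->
     (forall j, lo < j < hi -> ~~ starts m j) ->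
     R 18 = has (fun j => cells st (3 * n + cells st (n + j))
                          != cells st (3 * n + cells st (n + lo)))
                (iota lo (hi - lo)) ->
     t <= tm st + 11 * (hi - lo) + 12 -> p <= 5 * n + 1 ->
     Q (State R (cells st) t p)) ->
  wp scan_code Q st.
Proof.
case: st => R0 mm t0 p0 /= cR R11 ltlo lt_phi markD le_p post.
have lt_phi_lo := lt_phi _ ltlo.
set ne := fun j : nat => mm (3 * n + mm (n + j)) != mm (3 * n + mm (n + lo)) in post.
have cR0 := constsE cR.
apply: wp_then; apply: wp_add => /=; rewrite !cR0 R11; first by lia.
apply: wp_then; apply: wp_const => /=; first by lia.
apply: wp_then; apply: wp_add => /=; rewrite !cR0 R11; first by lia.
apply: wp_then; apply: wp_load => /=.
apply: wp_then; apply: wp_add => /=; rewrite !cR0; first by lia.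
apply: wp_then; apply: wp_load => /=.
apply: wp_then; apply: wp_add => /=; rewrite !cR0; first by lia.
apply: wp_then; apply: wp_load => /=.
apply: (@wp_while _ _ _ _ _ _ _ (fun h st =>
  [/\ same [:: 9; 12; 16; 17; 18] R0 (reg st), cells st = mm,
      [/\ reg st 12 = h, lo < h <= n & forall j, lo < j < h -> ~~ starts m j],
      [/\ reg st 16 = starts m h, reg st 17 = mm (3 * n + mm (n + lo))
        & reg st 18 = has ne (iota lo (h - lo))]
    & tm st <= t0 + 8 + 11 * (h - lo) /\ sp st <= 5 * n + 1]) n _ lo.+1).
- split=> //=.
  + by do 8?apply: same_setr.
  + by split; [lia | lia | move=> j; lia].
  + split=> //; first by rewrite markD addn1.
    by rewrite subSnn /= /ne eqxx.
  + by split; lia.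
- move=> h [R mm' t p] /= [sR -> [R12 /andP[lth leh] inner] [R16 R17 R18] [le_t lep]].
  have cR' := constsE (consts_same (l := [:: 9; 12; 16; 17; 18]) isT sR cR).
  rewrite R16 !cR' => st_h; have {}st_h : ~~ starts m h by case: (starts m h) st_h.
  (* Row [n] is always marked, so the scan cannot leave the array. *)
  have lthn : h < n.
    rewrite ltn_neqAle leh andbT; apply: contra st_h => /eqP ->.
    exact: starts_end.
  have := lt_phi _ lthn => lt_phi_h.
  apply: wp_then; apply: wp_add => /=; rewrite !cR' R12; first by lia.
  apply: wp_then; apply: wp_load => /=.
  apply: wp_then; apply: wp_add => /=; rewrite !cR'; first by lia.
  apply: wp_then; apply: wp_load => /=.
  have has_S : has ne (iota lo (h.+1 - lo)) = has ne (iota lo (h - lo)) || ne h.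
    have -> : h.+1 - lo = (h - lo) + 1 by lia.
    by rewrite iotaD has_cat /= orbF subnKC // ltnW.
  have inner' j : lo < j < h.+1 -> ~~ starts m j.
    rewrite ltnS [j <= h]leq_eqVlt => /andP[ltj /orP[/eqP->//|ltjh]].
    by apply: inner; rewrite ltj.
  have st_S : mm (4 * n + (h + 1)) = starts m h.+1 by rewrite addn1 markD.
  apply: wp_then; apply: wp_ifne => /=; rewrite R17 => cmp.
    apply: wp_add => /=; rewrite !cR'; first by lia.
    apply: wp_then; apply: wp_add => /=; rewrite !cR' R12; first by lia.
    apply: wp_then; apply: wp_add => /=; rewrite !cR'; first by lia.
    apply: wp_load => /=; exists h.+1; first by lia.
    split=> //=.
    + by do 8?apply: same_setr.
    + by split=> //; lia.
    + split=> //; rewrite has_S (_ : ne h); first by rewrite orbT.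
      exact/eqP.
    + by split; lia.
  apply: wp_then; apply: wp_add => /=; rewrite !cR' R12; first by lia.
  apply: wp_then; apply: wp_add => /=; rewrite !cR'; first by lia.
  apply: wp_load => /=; exists h.+1; first by lia.
  split=> //=.
  + by do 8?apply: same_setr.
  + by split=> //; lia.
  + by split=> //; rewrite has_S R18 [ne h]/ne cmp eqxx orbF.
  + by split; lia.
- move=> h [R mm' t p] /= [sR -> [R12 /andP[lth leh] inner] [R16 R17 R18] [le_t lep]].
  have cR' := constsE (consts_same (l := [:: 9; 12; 16; 17; 18]) isT sR cR).
  rewrite R16 !cR' => st_h; have {}st_h : starts m h by case: (starts m h) st_h.
  by apply: (post R h) => //=; lia.
Qed.

Lemma copy_spec lo hi (Q : state -> Prop) st :
  lo < hi -> hi <= n ->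
  consts (reg st) -> reg st 11 = lo -> reg st 12 = hi ->
  sp st <= 5 * n + 1 ->
  (forall R mm t p,
     same [:: 9; 15; 16] (reg st) R ->
     (forall x, lo <= x < hi -> mm (n + x) = cells st (2 * n + x)) ->
     (forall x, ~~ (n + lo <= x < n + hi) -> mm x = cells st x) ->
     t <= tm st + 7 * (hi - lo) + 3 -> p <= 5 * n + 1 ->
     Q (State R mm t p)) ->
  wp copy_code Q st.
Proof.
case: st => R0 mm1 t0 p0 /= lthi lehi cR R11 R12 le_p post.
have cR0 := constsE cR.
apply: wp_then; apply: wp_add => /=; rewrite !cR0 R11; first by lia.
apply: (@wp_while _ _ _ _ _ _ _ (fun r st =>
  [/\ same [:: 9; 15; 16] R0 (reg st), reg st 15 = r, lo <= r <= hi,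
      (forall x, lo <= x < r -> cells st (n + x) = mm1 (2 * n + x)) /\
      (forall x, ~~ (n + lo <= x < n + r) -> cells st x = mm1 x)
    & tm st <= t0 + 1 + 7 * (r - lo) /\ sp st <= 5 * n + 1]) n _ lo).
- split=> //=.
  + by do 2?apply: same_setr.
  + by rewrite addn0.
  + by lia.
  + by split=> // x; lia.
  + by split; lia.
- move=> r [R mm t p] /= [sR R15 /andP[ler lerh] [mnew mold] [le_t lep]].
  rewrite R15 (sR 12) // R12 => ltr.
  have cR' := constsE (consts_same (l := [:: 9; 15; 16]) isT sR cR).
  apply: wp_then; apply: wp_add => /=; rewrite !cR' R15; first by lia.
  apply: wp_then; apply: wp_load => /=; rewrite mold; last by lia.
  apply: wp_then; apply: wp_add => /=; rewrite !cR' R15; first by lia.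
  apply: wp_then; apply: wp_store => /=.
  apply: wp_add => /=; rewrite !cR' R15; first by lia.
  exists r.+1; first by lia.
  split=> //=; [by do 4?apply: same_setr | lia | lia | | by split; lia].
  split=> x lex; last by rewrite update_other ?mold //; lia.
  case: (eqVneq x r) => [->|ne_x]; first by rewrite update_same.
  by rewrite update_other ?mnew //; lia.
- move=> r [R mm t p] /= [sR R15 /andP[ler lerh] [mnew mold] [le_t lep]].
  rewrite R15 (sR 12) // R12 => ger; have eq_r : r = hi by lia.
  rewrite eq_r in mnew mold le_t.
  by apply: post => //=; lia.
Qed.

(** * Sorting one block in scratch memory *)

Section Sorting.

Variables (mm0 : nat -> nat) (m lo hi : nat).
Hypotheses (ltm : m < n) (lthi : lo < hi) (lehi : hi <= n).
Hypothesis lt_phi : forall q, q < n -> mm0 (n + q) < n.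
Hypothesis mm0E : forall q, q < n -> mm0 (3 * n + q) = rsym q m.

Let seg := [seq mm0 (n + j) | j <- iota lo (hi - lo)].

(** [l] is the part of the sorted block written so far; only the scratch array may differ from
    [mm0]. *)
Definition holds (mm : nat -> nat) (l : seq nat) :=
  (forall x, (x < 2 * n) || (3 * n <= x) -> mm x = mm0 x) /\
  (forall t, t < size l -> mm (2 * n + (lo + t)) = nth 0 l t).

Lemma bucket_spec a l (Q : state -> Prop) st :
  consts (reg st) -> reg st 11 = lo -> reg st 12 = hi ->
  reg st 14 = lo + size l -> reg st 17 = a -> holds (cells st) l ->
  let l' := l ++ [seq q <- seg | rsym q m == a] in
  size l' <= hi - lo -> sp st <= 5 * n + 1 ->
  (forall R mm t p,
     same [:: 9; 14; 15; 16] (reg st) R -> R 14 = lo + size l' -> holds mm l' ->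
     t <= tm st + 11 * (hi - lo) + 3 -> p <= 5 * n + 1 -> Q (State R mm t p)) ->
  wp bucket_code Q st.
Proof.
case: st => R0 mm1 t0 p0 /= cR R11 R12 R14 R17 hl le_l' le_p post.
have cR0 := constsE cR.
apply: wp_then; apply: wp_add => /=; rewrite !cR0 R11; first by lia.
pose part r := l ++ [seq q <- [seq mm0 (n + j) | j <- iota lo (r - lo)] | rsym q m == a].
apply: (@wp_while _ _ _ _ _ _ _ (fun r st =>
  [/\ same [:: 9; 14; 15; 16] R0 (reg st), reg st 15 = r, lo <= r <= hi,
      reg st 14 = lo + size (part r) /\ holds (cells st) (part r)
    & tm st <= t0 + 1 + 11 * (r - lo) /\ sp st <= 5 * n + 1]) n _ lo).
- split=> //=.
  + by do 2?apply: same_setr.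
  + by rewrite addn0.
  + lia.
  + by rewrite /part subnn /= cats0.
  + by split; lia.
- move=> r [R mm t p] /= [sR R15 /andP[ler lerh] [R14' hp] [le_t lep]].
  rewrite R15 (sR 12) // R12 => ltr.
  have cR' := constsE (consts_same (l := [:: 9; 14; 15; 16]) isT sR cR).
  have ltrn : r < n by lia.
  have lt_phi_r := lt_phi ltrn.
  have [fr hd] := hp.
  have partS : part r.+1 = part r ++
      (if rsym (mm0 (n + r)) m == a then [:: mm0 (n + r)] else [::]).
    rewrite /part; have -> : r.+1 - lo = (r - lo) + 1 by lia.
    by rewrite iotaD map_cat filter_cat catA subnKC.
  (* The output never exceeds the room of the block, so no store runs beyond the scratch array. *)
  have le_part : size (part r.+1) <= hi - lo.
    apply: leq_trans le_l'; rewrite /part !size_cat leq_add2l /seg.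
    have -> : hi - lo = (r.+1 - lo) + (hi - r.+1) by lia.
    by rewrite iotaD map_cat filter_cat size_cat leq_addr.
  apply: wp_then; apply: wp_add => /=; rewrite !cR' R15; first by lia.
  apply: wp_then; apply: wp_load => /=; rewrite fr; last by lia.
  apply: wp_then; apply: wp_add => /=; rewrite !cR'; first by lia.
  apply: wp_then; apply: wp_load => /=; rewrite fr; last by lia.
  rewrite mm0E //.
  apply: wp_then; apply: wp_ifeq => /=; rewrite (sR 17) // R17 => cmp.
    rewrite cmp eqxx in partS; rewrite partS size_cat addn1 in le_part.
    apply: wp_then; apply: wp_add => /=; rewrite !cR' R14'; first by lia.
    apply: wp_then; apply: wp_store => /=.
    apply: wp_add => /=; rewrite !cR' R14'; first by lia.
    apply: wp_add => /=; rewrite !cR' R15; first by lia.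
    exists r.+1; first by lia.
    split=> //=; [by do 8?apply: same_setr | lia | lia | | by split; lia].
    rewrite partS size_cat /=; split; first by lia.
    split=> [x lex | x]; first by rewrite update_other ?fr //; lia.
    rewrite size_cat addn1 ltnS leq_eqVlt => /orP[/eqP->|ltx].
      by rewrite update_same nth_cat ltnn subnn.
    by rewrite update_other ?hd ?nth_cat ?ltx //; lia.
  have /eqP/negPf cmp' := cmp; rewrite cmp' cats0 in partS.
  apply: wp_add => /=; rewrite !cR' R15; first by lia.
  exists r.+1; first by lia.
  split=> //=; [by do 8?apply: same_setr | lia | lia | by rewrite partS | by split; lia].
- move=> r [R mm t p] /= [sR R15 /andP[ler lerh] [R14' hp] [le_t lep]].
  rewrite R15 (sR 12) // R12 => ger; have eq_r : r = hi by lia.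
  rewrite eq_r in R14' hp le_t.
  by apply: post => //=; lia.
Qed.

Let lst := listing (pi (take m (row s pi lo))).

Lemma read_prefix mm :
  (forall x, x < m -> mm x = sym lo x) ->
  read_string sigma mm 0 m = Some (take m (row s pi lo)).
Proof.
move=> mmE; rewrite /read_string.
have -> : [seq mm t | t <- iota 0 m] = [seq val a | a <- take m (row s pi lo)].
  have sz : size (take m (row s pi lo)) = m.
    by rewrite size_take_min size_row //; lia.
  apply: (@eq_from_nth _ 0); rewrite !size_map size_iota ?sz //.
  move=> x ltx; rewrite (nth_map 0) ?size_iota // (nth_map c0) ?sz //.
  by rewrite nth_iota // add0n mmE // nth_take.
rewrite (map_pK valK) ifT //.
by apply/allP => x /mapP[a _ ->]; apply: ltn_ord.
Qed.

Lemma sort_spec (Q : state -> Prop) st :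
  consts (reg st) -> reg st 10 = m -> reg st 11 = lo -> reg st 12 = hi ->
  cells st = mm0 -> (forall x, x < m -> mm0 x = sym lo x) ->
  sp st <= 5 * n + 1 ->
  (forall R mm t p,
     same [:: 9; 13; 14; 15; 16; 17] (reg st) R ->
     holds mm (sorted_block s pi c0 (fun q => mm0 (n + q)) m lo hi) ->
     t <= tm st + 4 + sigma * (m + 11 * (hi - lo) + 7) -> p <= 5 * n + 1 ->
     Q (State R mm t p)) ->
  wp sort_code Q st.
Proof.
case: st => R0 mm1 t0 p0 /= cR R10 R11 R12 -> pref le_p post.
have cR0 := constsE cR.
apply: wp_then; apply: wp_add => /=; rewrite !cR0 R11; first by lia.
apply: wp_then; apply: wp_const => /=; first by lia.
have sz_lst : size lst = sigma by rewrite size_sort size_enum_ord.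
pose done k := buckets (fun q => rsym q m) [seq val a | a <- take k lst] seg.
have done_all : done sigma = sorted_block s pi c0 (fun q => mm0 (n + q)) m lo hi.
  by rewrite /done take_oversize ?sz_lst.
(* Cost of one round: a query of [m + 1], 11 per row of the block, and 6 further instructions. *)
pose T := m + 11 * (hi - lo) + 7.
apply: (@wp_while _ _ _ _ _ _ _ (fun k st =>
  [/\ same [:: 9; 13; 14; 15; 16; 17] R0 (reg st), reg st 13 = k, k <= sigma,
      reg st 14 = lo + size (done k) /\ holds (cells st) (done k)
    & tm st <= t0 + 2 + k * T /\ sp st <= 5 * n + 1]) sigma _ 0).
- split=> //=.
  + by do 2?apply: same_setr.
  + by rewrite /done take0.
  + by split; lia.
- move=> k [R mm t p] /= [sR R13 lek [R14 hd] [le_t lep]].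
  have cR' := consts_same (l := [:: 9; 13; 14; 15; 16; 17]) isT sR cR.
  rewrite R13 !(constsE cR') => ltk.
  have [fr _] := hd.
  pose b := nth c0 lst k.
  have onth_b : onth lst k = Some b by rewrite onthE (nth_map c0) ?sz_lst.
  have doneS : done k.+1 = done k ++ [seq q <- seg | rsym q m == val b].
    rewrite /done (take_nth c0) ?sz_lst // map_rcons -cats1 /buckets.
    by rewrite map_cat flatten_cat /= cats0.
  (* What is written so far is an initial part of the sorted block, which has [hi - lo] entries. *)
  have le_done : size (done k.+1) <= hi - lo.
    rewrite -(@size_sorted_block sigma n s pi c0 (fun q => mm0 (n + q)) m lo hi).
    rewrite -done_all {2}/done take_oversize ?sz_lst //.
    rewrite -(cat_take_drop k.+1 lst) /buckets !map_cat flatten_cat size_cat.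
    exact: leq_addr.
  apply: wp_then; apply: wp_order => /=.
  + by rewrite !(constsE cR') (sR 10) // R10; lia.
  + rewrite !(constsE cR') (sR 10) // R10; apply: read_prefix => x ltx.
    by rewrite fr ?pref //; lia.
  + by rewrite R13; exact: onth_b.
  rewrite (sR 10) // R10 (constsE cR').
  apply: wp_then; apply: (bucket_spec (a := val b) (l := done k)) => //=.
  + by apply: (consts_same (l := [:: 17]) isT _ cR'); apply: same_setr.
  + by rewrite sR.
  + by rewrite sR.
  + by rewrite -doneS.
  + by lia.
  move=> R' mm' t' p' sR' R14' hd' le_t' lep'.
  rewrite -doneS in R14' hd'.
  have R13' : R' 13 = k by rewrite sR'.
  have R3' : R' 3 = 1 by rewrite sR' //= (constsE cR').
  apply: wp_add => /=; rewrite R13' R3'; first by lia.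
  exists k.+1; first by lia.
  split=> //=; [ | lia | ].
  + apply: same_setr => // x x_l; rewrite sR' /=; last first.
      by apply: contra x_l; rewrite !inE; case/or4P => ->; rewrite ?orbT.
    rewrite -[eqn x 17]/(x == 17); case: eqP x_l => [->//|_ x_l]; exact: sR.
  + by rewrite mulSn; split; rewrite /T in le_t *; lia.
- move=> k [R mm t p] /= [sR R13 lek [R14 hd] [le_t lep]].
  have cR' := consts_same (l := [:: 9; 13; 14; 15; 16; 17]) isT sR cR.
  rewrite R13 !(constsE cR') => gek; have eq_k : k = sigma by lia.
  rewrite eq_k done_all in hd; rewrite eq_k /T in le_t.
  by apply: post => //=; lia.
Qed.

End Sorting.

Lemma branch_spec (m lo hi : nat) (Q : state -> Prop) st :
  m < n -> lo < hi -> hi <= n ->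
  (forall q, q < n -> cells st (n + q) < n) ->
  (forall q, q < n -> cells st (3 * n + q) = rsym q m) ->
  (forall q t, q < n -> t < m -> rsym (cells st (n + q)) t = sym q t) ->
  consts (reg st) -> reg st 10 = m -> reg st 11 = lo -> reg st 12 = hi ->
  sp st <= 5 * n + 1 ->
  (forall R mm t p,
     same [:: 9; 13; 14; 15; 16; 17] (reg st) R ->
     (forall q, q < n -> mm (n + q) =
        refined s pi c0 (fun x => cells st (n + x)) m lo hi q) ->
     (forall x, 3 * n <= x -> mm x = cells st x) ->
     t <= tm st + 7 * m + 7 * (hi - lo) + 11
          + sigma * (m + 11 * (hi - lo) + 7) ->
     p <= 5 * n + 1 -> Q (State R mm t p)) ->
  wp branch_code Q st.
Proof.
case: st => R0 mm0 t0 p0 /= ltm lthi lehi lt_phi mm0E agr cR R10 R11 R12 le_p post.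
have cR0 := constsE cR.
apply: wp_then; apply: wp_add => /=; rewrite !cR0 R11; first by lia.
apply: wp_then; apply: (extract_spec (m := m) (q0 := lo)) => //=; try lia.
  by apply: (consts_same (l := [:: 16]) isT _ cR); apply: same_setr.
move=> R1 mm1 t1 p1 sR1 pref1 fr1 le_t1 lep1.
have {}sR1 : same [:: 9; 13; 14; 15; 16; 17] R0 R1.
  move=> x; rewrite !inE !negb_or => /and5P[x9 x13 x14 x15 /andP[x16 x17]].
  rewrite sR1 /=; first by rewrite -[eqn x 16]/(x == 16) (negPf x16).
  by rewrite !inE !negb_or x9 x15 x16.
have cR1 := consts_same (l := [:: 9; 13; 14; 15; 16; 17]) isT sR1 cR.
apply: wp_then.
apply: (@sort_spec mm1 m lo hi) => //=; rewrite ?sR1 //.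
- by move=> q ltq; rewrite fr1 ?lt_phi //; lia.
- by move=> q ltq; rewrite fr1 ?mm0E //; lia.
move=> R2 mm2 t2 p2 sR2 [fr2 hd2] le_t2 lep2.
have {}sR2 : same [:: 9; 13; 14; 15; 16; 17] R0 R2 by apply: same_trans sR1 sR2.
have cR2 := consts_same (l := [:: 9; 13; 14; 15; 16; 17]) isT sR2 cR.
apply: (copy_spec (lo := lo) (hi := hi)) => //=; rewrite ?sR2 //.
move=> R3 mm3 t3 p3 sR3 mnew mold le_t3 lep3.
(* Extraction wrote only below address [m], so the block was sorted from the original phi. *)
have sbE : sorted_block s pi c0 (fun q => mm1 (n + q)) m lo hi
         = sorted_block s pi c0 (fun q => mm0 (n + q)) m lo hi.
  rewrite /sorted_block; congr buckets; apply/eq_in_map => q _.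
  by apply: fr1; lia.
apply: post; [ | | | lia | exact: lep3].
- apply: same_trans sR2 _ => // x x_l; apply: sR3.
  by apply: contra x_l; rewrite !inE; case/or3P => ->; rewrite ?orbT.
- move=> q ltq; rewrite /refined; case: ifP => inq; last first.
    by rewrite mold ?fr2 ?fr1 //; lia.
  rewrite mnew // -sbE -hd2; first by congr mm2; lia.
  by rewrite size_sorted_block; lia.
- by move=> x lex; rewrite mold ?fr2 ?fr1 //; lia.
Qed.

(* Blocks below row lo have already been refined to m + 1 symbols. *)
Definition level m lo (mm : nat -> nat) :=
  [/\ perm_eq [seq mm (n + q) | q <- iota 0 n] (iota 0 n),
      forall q t, q < n -> t < m + (q < lo) -> rsym (mm (n + q)) t = sym q t,
      m < n -> forall q, q < n -> mm (3 * n + q) = rsym q m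
    & forall t, t <= n -> mm (4 * n + t) = starts m t].

Lemma level_lt m lo mm : level m lo mm -> forall q, q < n -> mm (n + q) < n.
Proof.
case=> /perm_mem perm_phi _ _ _ q ltq.
have := perm_phi (mm (n + q)); rewrite mem_iota leq0n andTb add0n => <-.
by apply: (map_f (fun q => mm (n + q))); rewrite mem_iota.
Qed.

(** * Amortised count of the splits *)

Definition nstarts m x := count (starts m) (iota 0 x).

Lemma nstarts_cat m lo hi : lo <= hi ->
  nstarts m hi = nstarts m lo + count (starts m) (iota lo (hi - lo)).
Proof. by move=> le; rewrite /nstarts -{1}(subnKC le) iotaD count_cat. Qed.

Definition phi_varies m lo hi (mm : nat -> nat) :=
  has (fun q => rsym (mm (n + q)) m != rsym (mm (n + lo)) m)
      (iota lo (hi - lo)).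

(** Openings persist at the next level, and a block whose keys vary gains at least one strictly
    inside. Sums on both sides replace a subtraction. *)
Lemma nstarts_block m lo hi mm :
  m < n -> lo < hi -> hi <= n -> level m lo mm -> starts m lo -> starts m hi ->
  (forall j, lo < j < hi -> ~~ starts m j) ->
  nstarts m.+1 lo + nstarts m hi + phi_varies m lo hi mm
  <= nstarts m.+1 hi + nstarts m lo.
Proof.
move=> ltm lthi lehi lv st_lo st_hi inner.
have blk := block_starts tot_pi n_gt0 lthi lehi st_lo st_hi inner.
rewrite !(nstarts_cat _ (ltnW lthi)).
have -> : hi - lo = (hi - lo.+1).+1 by lia.
rewrite /= st_lo (starts_mono c0) //; last by lia.
have -> : count (starts m) (iota lo.+1 (hi - lo.+1)) = 0.
  apply/eqP; rewrite eqn0Ngt -has_count; apply/hasPn => j.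
  by rewrite mem_iota => inj; apply: inner; lia.
set news := count _ _.
suff : phi_varies m lo hi mm <= news.
  by move: (nat_of_bool _) => v; rewrite /nat_of_bool; lia.
rewrite {}/news.
case var: (phi_varies m lo hi mm) => //; rewrite -has_count; apply/hasP.
have [perm_phi agr _ _] := lv.
have [|j inj stj] := varying_block_starts n_gt0 perm_phi _ ltm lthi lehi blk var.
  by move=> q t ltq ltt; apply: agr => //; lia.
by exists j => //; rewrite mem_iota; lia.
Qed.

Lemma level_skip m lo hi mm :
  m < n -> hi <= n -> block s pi m lo hi -> lo < hi -> level m lo mm ->
  ~~ phi_varies m lo hi mm -> level m hi mm.
Proof.
move=> ltm lehi blk lthi [perm_phi agr keys marks] const.
split=> // q t ltq; case: (ltnP q lo) => [lt_lo|ge_lo].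
  by rewrite (_ : q < hi); [move=> ltt; apply: agr => //; rewrite lt_lo | lia].
case: (ltnP q hi) => [lt_hi|ge_hi] ltt; last by apply: agr => //; lia.
have [lttm|gett] := ltnP t m; first by apply: agr => //; lia.
have -> : t = m by lia.
apply: (constant_block_agree n_gt0 perm_phi _ ltm lthi lehi blk const); last by lia.
by move=> p u ltp ltu; apply: agr => //; lia.
Qed.

Lemma level_refine m lo hi mm mm' :
  m < n -> hi <= n -> block s pi m lo hi -> lo < hi -> level m lo mm ->
  (forall q, q < n -> mm' (n + q) =
     refined s pi c0 (fun x => mm (n + x)) m lo hi q) ->
  (forall x, 3 * n <= x -> mm' x = mm x) ->
  level m hi mm'.
Proof.
move=> ltm lehi blk lthi [perm_phi agr keys marks] phiE same_hi.
have agr' q t : q < n -> t < m -> rsym (mm (n + q)) t = sym q t.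
  by move=> ltq ltt; apply: agr => //; lia.
split.
- rewrite (_ : map _ _ = [seq refined s pi c0 (fun x => mm (n + x)) m lo hi q
                         | q <- iota 0 n]).
    exact: perm_refined.
  by apply/eq_in_map => q; rewrite mem_iota => ltq; apply: phiE.
- move=> q t ltq ltt; rewrite phiE // /refined; case: ifP => inq.
    apply: (sorted_block_agree tot_pi n_gt0 perm_phi agr' ltm lthi lehi blk inq).
    by lia.
  by apply: agr => //; lia.
- by move=> _ q ltq; rewrite same_hi ?keys //; lia.
- by move=> t let_; rewrite same_hi ?marks //; lia.
Qed.

Let block_regs := [:: 9; 11; 12; 13; 14; 15; 16; 17; 18].

(** A branch costs O(sigma m) for the extraction and the queries, charged to the opening it creates,
    and O(sigma) per row of the block, charged to the rows. The term in [nstarts m n] stands on the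
    left in place of a subtraction. *)
Lemma blocks_spec m (Q : state -> Prop) st :
  consts (reg st) -> reg st 10 = m -> m < n -> level m 0 (cells st) ->
  sp st <= 5 * n + 1 ->
  (forall R mm t p,
     same block_regs (reg st) R -> level m n mm ->
     t + 70 * (sigma * n) * nstarts m n
       <= tm st + 3 + 70 * (sigma * n) + 70 * (sigma * n) * nstarts m.+1 n ->
     p <= 5 * n + 1 -> Q (State R mm t p)) ->
  wp blocks_code Q st.
Proof.
case: st => R0 mm0 t0 p0 /= cR R10 ltm lv0 le_p post.
have cR0 := constsE cR.
have sigma_gt0 : 0 < sigma by case: c0 => x; case: (sigma).
apply: wp_then; apply: wp_const => /=; first by lia.
pose S := 70 * (sigma * n).
apply: (@wp_while _ _ _ _ _ _ _ (fun lo st =>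
  [/\ same block_regs R0 (reg st), reg st 11 = lo, lo <= n /\ starts m lo,
      level m lo (cells st)
    & tm st + S * nstarts m lo
        <= t0 + 1 + 70 * (sigma * lo) + S * nstarts m.+1 lo /\
      sp st <= 5 * n + 1]) n _ 0).
- split=> //=; first by do 2?apply: same_setr.
  by split; rewrite /nstarts /=; lia.
- move=> lo [R mm t p] /= [sR R11 [lelo st_lo] lv [le_t lep]].
  have cR' := consts_same (l := block_regs) isT sR cR.
  rewrite R11 !(constsE cR') => ltlo.
  have [perm_phi agr keys marks] := lv.
  have lt_phi := level_lt lv.
  apply: wp_then; apply: (scan_spec (m := m) (lo := lo)) => //=.
  move=> R1 hi t1 p1 sR1 R12 lthi lehi st_hi inner R18 le_t1 lep1.
  have R11' : R1 11 = lo by rewrite sR1.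
  have {}sR1 : same block_regs R0 R1.
    move=> x x_l; rewrite sR1 ?sR //; apply: contra x_l.
    by rewrite !inE; case/or4P => [->|->|->|/orP[]->]; rewrite ?orbT.
  have cR1 := consts_same (l := block_regs) isT sR1 cR.
  have R10' : R1 10 = m by rewrite sR1.
  have blk := block_starts tot_pi n_gt0 lthi lehi st_lo st_hi inner.
  have {}R18 : R1 18 = phi_varies m lo hi mm.
    rewrite R18; congr nat_of_bool; apply: eq_in_has => q; rewrite mem_iota => inq.
    by rewrite !keys ?lt_phi //; lia.
  (* Each new opening carries a credit of [S], enough for the part of a branch that depends on
     [m]. *)
  have := nstarts_block ltm lthi lehi lv st_lo st_hi inner.
  rewrite -(leq_pmul2l (_ : 0 < S)); last by rewrite /S !muln_gt0 sigma_gt0 n_gt0.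
  rewrite !mulnDr => potential.
  have eS : S = 70 * (sigma * n) by [].
  have splt : sigma * hi = sigma * lo + sigma * (hi - lo).
    by rewrite -mulnDr subnKC // ltnW.
  have le1 : hi - lo <= sigma * (hi - lo) by rewrite leq_pmull.
  have le2 : sigma <= sigma * (hi - lo) by rewrite leq_pmulr // subn_gt0.
  have le3 : m <= sigma * m by rewrite leq_pmull.
  have le4 : sigma * m <= sigma * n by rewrite leq_mul2l ltnW ?orbT.
  apply: wp_then; apply: wp_ifne => /=; rewrite R18 !(constsE cR1) => var.
    have {}var : phi_varies m lo hi mm by case: (phi_varies _ _ _ _) var.
    rewrite var muln1 in potential.
    apply: (branch_spec (m := m) (lo := lo) (hi := hi)) => //=.
    + exact: keys.
    + by move=> q u ltq ltu; apply: agr => //; lia.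
    move=> R2 mm2 t2 p2 sR2 phiE same_hi le_t2 lep2.
    have {}sR2 : same block_regs R0 R2 /\ R2 12 = hi.
      split; last by rewrite sR2.
      move=> x x_l; rewrite sR2 ?sR1 //; apply: contra x_l.
      by rewrite !inE; case/or4P => [->|->|->|/or3P[]->]; rewrite ?orbT.
    case: sR2 => sR2 R12'.
    have cR2 := constsE (consts_same (l := block_regs) isT sR2 cR).
    apply: wp_add => /=; rewrite cR2 R12'; first by lia.
    exists hi; first by lia.
    split=> //=; [by apply: same_setr | lia | exact: level_refine lv _ _ | ].
    split=> //.
    have e : sigma * (m + 11 * (hi - lo) + 7)
             = sigma * m + 11 * (sigma * (hi - lo)) + 7 * sigma.
      by move: (hi - lo) => l; lia.
    rewrite {}e in le_t2; lia.
  have {}var : ~~ phi_varies m lo hi mm by case: (phi_varies _ _ _ _) var.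
  rewrite (negPf var) muln0 in potential.
  apply: wp_add => /=; rewrite !(constsE cR1) R12; first by lia.
  exists hi; first by lia.
  split=> //=; [by apply: same_setr | lia | exact: level_skip lv _ | ].
  by split=> //; lia.
- move=> lo [R mm t p] /= [sR R11 [lelo st_lo] lv [le_t lep]].
  have cR' := consts_same (l := block_regs) isT sR cR.
  rewrite R11 !(constsE cR') => gelo; have eq_lo : lo = n by lia.
  rewrite eq_lo /S in lv le_t.
  by apply: post => //=; lia.
Qed.

(** E at phi(q) is column [m] of the rotated row phi(q); by agreement on [m + 1] symbols this is
    column [m] of row q. *)
Lemma shift_spec m (Q : state -> Prop) st :
  consts (reg st) -> m < n -> level m n (cells st) -> sp st <= 5 * n + 1 ->
  (forall R mm t p,
     same [:: 9; 15; 16] (reg st) R ->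
     (forall q, q < n -> mm (2 * n + q) = sym q m) ->
     (forall x, ~~ (2 * n <= x < 3 * n) -> mm x = cells st x) ->
     t <= tm st + 9 * n + 3 -> p <= 5 * n + 1 -> Q (State R mm t p)) ->
  wp shift_code Q st.
Proof.
case: st => R0 mm0 t0 p0 /= cR ltm lv le_p post.
have [_ agr keys _] := lv; have lt_phi := level_lt lv.
apply: wp_then; apply: wp_const => /=; first by lia.
apply: (@wp_while _ _ _ _ _ _ _ (fun r st =>
  [/\ same [:: 9; 15; 16] R0 (reg st), reg st 15 = r, r <= n,
      (forall q, q < r -> cells st (2 * n + q) = sym q m) /\
      (forall x, ~~ (2 * n <= x < 3 * n) -> cells st x = mm0 x)
    & tm st <= t0 + 1 + 9 * r /\ sp st <= 5 * n + 1]) n _ 0).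
- split=> //=; first by do 2?apply: same_setr.
  by split; lia.
- move=> r [R mm t p] /= [sR R15 ler [new old] [le_t lep]].
  have cR' := constsE (consts_same (l := [:: 9; 15; 16]) isT sR cR).
  rewrite R15 cR' => ltr; have lt_phi_r := lt_phi _ ltr.
  apply: wp_then; apply: wp_add => /=; rewrite !cR' R15; first by lia.
  apply: wp_then; apply: wp_load => /=; rewrite old; last by lia.
  apply: wp_then; apply: wp_add => /=; rewrite !cR'; first by lia.
  apply: wp_then; apply: wp_load => /=; rewrite old; last by lia.
  apply: wp_then; apply: wp_add => /=; rewrite !cR' R15; first by lia.
  apply: wp_then; apply: wp_store => /=.
  rewrite keys // agr //; last by rewrite ltr addn1.
  apply: wp_add => /=; rewrite !cR' R15; first by lia.
  exists r.+1; first by lia.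
  split=> //=; [by do 8?apply: same_setr | lia | | by split; lia].
  split=> x lex; last by rewrite update_other ?old //; lia.
  case: (eqVneq x r) => [->|ne_x]; first by rewrite update_same.
  by rewrite update_other ?new //; lia.
- move=> r [R mm t p] /= [sR R15 ler [new old] [le_t lep]].
  have cR' := constsE (consts_same (l := [:: 9; 15; 16]) isT sR cR).
  rewrite R15 cR' => ger; have eq_r : r = n by lia.
  rewrite eq_r in new le_t.
  by apply: post => //=; lia.
Qed.

Lemma mark_spec m (Q : state -> Prop) st :
  consts (reg st) -> m < n ->
  (forall q, q < n -> cells st (2 * n + q) = sym q m) ->
  (forall t, t <= n -> cells st (4 * n + t) = starts m t) ->
  sp st <= 5 * n + 1 ->
  (forall R mm t p,
     same [:: 9; 15; 16; 17] (reg st) R ->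
     (forall x, x < 3 * n -> mm x = cells st x) ->
     (forall q, q < n -> mm (3 * n + q) = sym q m) ->
     (forall t, t <= n -> mm (4 * n + t) = starts m.+1 t) ->
     t <= tm st + 12 * n + 3 -> p <= 5 * n + 1 -> Q (State R mm t p)) ->
  wp mark_code Q st.
Proof.
case: st => R0 mm0 t0 p0 /= cR ltm keys marks le_p post.
apply: wp_then; apply: wp_const => /=; first by lia.
(* Marks up to row [r] are already those of level [m + 1], the later ones still those of level
   [m]. *)
apply: (@wp_while _ _ _ _ _ _ _ (fun r st =>
  [/\ same [:: 9; 15; 16; 17] R0 (reg st), reg st 15 = r, r <= n,
      [/\ forall x, x < 3 * n -> cells st x = mm0 x,
          forall q, q < r -> cells st (3 * n + q) = sym q m
        & forall t, t <= n ->
            cells st (4 * n + t) = starts (m + (t <= r)) t]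
    & tm st <= t0 + 1 + 12 * r /\ sp st <= 5 * n + 1]) n _ 0).
- split=> //=; first by do 2?apply: same_setr.
    split=> // t let_; rewrite marks //.
    by case: t let_ => [|t] _ //=; rewrite addn0.
  by split; lia.
- move=> r [R mm t p] /= [sR R15 ler [low new mk] [le_t lep]].
  have cR' := constsE (consts_same (l := [:: 9; 15; 16; 17]) isT sR cR).
  rewrite R15 cR' => ltr.
  apply: wp_then; apply: wp_add => /=; rewrite !cR' R15; first by lia.
  apply: wp_then; apply: wp_load => /=; rewrite low ?keys //; last by lia.
  apply: wp_then; apply: wp_add => /=; rewrite !cR' R15; first by lia.
  apply: wp_then; apply: wp_store => /=.
  apply: wp_then; apply: wp_add => /=; rewrite !cR' R15 (addn1 r); first by lia.
  apply: wp_then; apply: wp_add => /=; rewrite !cR'; first by lia.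
  apply: wp_then; apply: wp_load => /=.
  have mark_old u : u <= n -> u != r.+1 ->
      mm (4 * n + u) = starts (m + (u <= r.+1)) u.
    by move=> leu neu; rewrite mk // [u <= r.+1]leq_eqVlt (negPf neu).
  have next : r.+1 < n ->
      starts m.+1 r.+1 = starts m r.+1 || (sym r m != mm (2 * n + r.+1)).
    by move=> ltr1; rewrite (startsS _ _ c0) // low ?keys //; lia.
  have last_ k : r.+1 = n -> starts k r.+1.
    by move=> ->; apply: starts_end.
  apply: wp_ifne => /= cmp.
    apply: wp_then; apply: wp_add => /=; rewrite !cR'; first by lia.
    apply: wp_store => /=; rewrite !cR'.
    exists r.+1; first by lia.
    split=> //=; [by do 8?apply: same_setr | | by split; lia].
    split=> [x ltx|q ltq|u leu].
    + by rewrite !update_other ?low //; lia.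
    + rewrite update_other; last by lia.
      case: (eqVneq q r) => [->|ne_q]; first by rewrite update_same.
      by rewrite update_other ?new //; lia.
    + case: (eqVneq u r.+1) => [->|ne_u].
        rewrite update_same leqnn addn1.
        case: (ltngtP r.+1 n) => [ltr1||eqr1]; [ | lia | by rewrite last_].
        rewrite next // (_ : sym r m != _) ?orbT //.
        by move: cmp; rewrite update_other; [move/eqP | lia].
      by rewrite !update_other ?mark_old //; lia.
  exists r.+1; first by lia.
  split=> //=; [by do 8?apply: same_setr | | by split; lia].
  split=> [x ltx|q ltq|u leu].
  + by rewrite !update_other ?low //; lia.
  + case: (eqVneq q r) => [->|ne_q]; first by rewrite update_same.
    by rewrite update_other ?new //; lia.
  + rewrite update_other; last by lia.
    case: (eqVneq u r.+1) => [eu|ne_u]; last exact: mark_old.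
    rewrite mk // eu ltnn leqnn addn0 addn1.
    case: (ltngtP r.+1 n) => [ltr1||eqr1]; [ | lia | by rewrite !last_].
    move: cmp; rewrite update_other; last by lia.
    by move=> cmp; rewrite next // -cmp eqxx orbF.
- move=> r [R mm t p] /= [sR R15 ler [low new mk] [le_t lep]].
  have cR' := constsE (consts_same (l := [:: 9; 15; 16; 17]) isT sR cR).
  rewrite R15 cR' => ger; have eq_r : r = n by lia.
  rewrite eq_r in new mk le_t.
  apply: post => //=; try lia.
  by move=> u leu; rewrite mk // leu addn1.
Qed.

(** The gains in openings telescope over the levels to at most [n], so their credits sum to at most
    70 sigma n^2; all other work stays within 110 sigma n per level. *)
Lemma levels_spec (Q : state -> Prop) st :
  consts (reg st) -> reg st 10 = 0 -> level 0 0 (cells st) ->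
  sp st <= 5 * n + 1 ->
  (forall R mm t p,
     consts R -> level n 0 mm -> t <= tm st + 180 * (sigma * n ^ 2) + 2 ->
     p <= 5 * n + 1 -> Q (State R mm t p)) ->
  wp levels_code Q st.
Proof.
case: st => R0 mm0 t0 p0 /= cR R10 lv0 le_p post.
have sigma_gt0 : 0 < sigma by case: c0 => x; case: (sigma).
have le_S : n <= sigma * n by rewrite leq_pmull.
apply: (@wp_while _ _ _ _ _ _ _ (fun m st =>
  [/\ consts (reg st), reg st 10 = m, m <= n, level m 0 (cells st)
    & tm st <= t0 + 110 * (sigma * n) * m + 70 * (sigma * n) * nstarts m n /\
      sp st <= 5 * n + 1]) n _ 0).
- by split=> //=; split=> //; lia.
- move=> m [R mm t p] /= [cR1 R10' lem lv [le_t lep]].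
  rewrite R10' !(constsE cR1) => ltm.
  apply: wp_then; apply: (blocks_spec (m := m)) => //=.
  move=> R2 mm2 t2 p2 sR2 lv2 le_t2 lep2.
  have cR2 := consts_same (l := block_regs) isT sR2 cR1.
  apply: wp_then; apply: (shift_spec (m := m)) => //=.
  move=> R3 mm3 t3 p3 sR3 keys3 fr3 le_t3 lep3.
  have cR3 := consts_same (l := [:: 9; 15; 16]) isT sR3 cR2.
  have [perm2 agr2 keys2 marks2] := lv2.
  apply: wp_then; apply: (mark_spec (m := m)) => //=.
    by move=> u leu; rewrite fr3 ?marks2 //; lia.
  move=> R4 mm4 t4 p4 sR4 low4 keys4 marks4 le_t4 lep4.
  have cR4 := consts_same (l := [:: 9; 15; 16; 17]) isT sR4 cR3.
  have R10'' : R4 10 = m by rewrite sR4 // sR3 // sR2.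
  apply: wp_add => /=; rewrite R10'' (constsE cR4); first by lia.
  have phi4 q : q < n -> mm4 (n + q) = mm2 (n + q).
    by move=> ltq; rewrite low4 ?fr3 //; lia.
  exists m.+1; first by lia.
  split=> //=.
  + by apply: (consts_same (l := [:: 10]) isT _ cR4); apply: same_setr.
  + by rewrite addn1.
  + split=> //.
    * rewrite (_ : map _ _ = [seq mm2 (n + q) | q <- iota 0 n]) //.
      by apply/eq_in_map => q; rewrite mem_iota => ltq; apply: phi4.
    * by move=> q u ltq ltu; rewrite phi4 ?agr2 // ltq; lia.
    (* Column [m] of row [q], now in E, is column [m + 1] of the rotated row, as the next level
       requires. *)
    * by move=> ltm1 q ltq; rewrite keys4 // rsymS.
  + split=> //; move: le_S le_t2 le_t; rewrite mulnS.
    move: (sigma * n) => S; move: (70 * S * _) (70 * S * _) => A B; lia.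
- move=> m [R mm t p] /= [cR1 R10' lem lv [le_t lep]].
  rewrite R10' !(constsE cR1) => gem; have eq_m : m = n by lia.
  rewrite eq_m in lv le_t; apply: post => //=.
  have le_n : nstarts n n <= n by rewrite (leq_trans (count_size _ _)) ?size_iota.
  have : 70 * (sigma * n) * nstarts n n <= 70 * (sigma * n) * n.
    by rewrite leq_mul2l le_n orbT.
  rewrite expnS expn1; lia.
Qed.

Lemma init_spec (Q : state -> Prop) st :
  reg st = nth 0 [:: n; sigma; i] -> cells st = (fun=> 0) ->
  tm st = 0 -> sp st = 0 -> i < n ->
  (forall R mm t p,
     consts R -> R 10 = 0 -> level 0 0 mm -> t <= 18 * n -> p <= 5 * n + 1 ->
     Q (State R mm t p)) ->
  wp init_code Q st.
Proof.
case: st => R0 mm0 t0 p0 /= -> -> -> -> lti post.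
apply: wp_then; apply: wp_const => /=; first by lia.
do 4![apply: wp_then; apply: wp_add => /=; first by lia].
set R1 := setr _ 7 _.
have cR1 : consts R1.
  by move=> x; rewrite /R1; do 9![case: x => [_ /=|x]; first by lia].
apply: wp_then; apply: (@wp_while _ _ _ _ _ _ _ (fun r st =>
  [/\ same [:: 9; 15; 16] R1 (reg st), reg st 15 = r, r <= n,
      [/\ forall q, q < r -> cells st (n + q) = q,
          forall q, q < r -> cells st (3 * n + q) = rsym q 0
        & forall x, 4 * n <= x -> cells st x = 0]
    & tm st <= 5 + 8 * r /\ sp st <= 5 * n + 1]) n _ 0).
- by split.
- move=> r [R mm t p] /= [sR R15 ler [phi keys marks] [le_t lep]].
  have cR' := constsE (consts_same (l := [:: 9; 15; 16]) isT sR cR1).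
  rewrite R15 cR' => ltr.
  have [a La aE] := @onth_ca_bwt sigma n s pi c0 n_gt0 r ltr.
  apply: wp_then; apply: wp_add => /=; rewrite !cR' R15; first by lia.
  apply: wp_then; apply: wp_store => /=; rewrite R15.
  apply: wp_then; apply: wp_last => /=; [rewrite R15; exact: La | rewrite {}aE].
  apply: wp_then; apply: wp_add => /=; rewrite !cR' R15; first by lia.
  apply: wp_then; apply: wp_store => /=.
  apply: wp_add => /=; rewrite !cR' R15; first by lia.
  exists r.+1; first by lia.
  split=> //=; [by do 8?apply: same_setr | lia | | by split; lia].
  split=> x ltx; last by rewrite !update_other ?marks //; lia.
    rewrite update_other; last by lia.
    case: (eqVneq x r) => [->|ne_x]; first by rewrite update_same.
    by rewrite update_other ?phi //; lia.
  case: (eqVneq x r) => [->|ne_x]; first by rewrite update_same.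
  by rewrite !update_other ?keys //; lia.
- move=> r [R mm t p] /= [sR R15 ler [phi keys marks] [le_t lep]].
  have cR2 := consts_same (l := [:: 9; 15; 16]) isT sR cR1.
  have cR' := constsE cR2.
  rewrite R15 cR' => ger; have eq_r : r = n by lia.
  rewrite eq_r in phi keys le_t.
  apply: wp_then; apply: wp_store => /=; rewrite !cR'.
  apply: wp_then; apply: wp_add => /=; rewrite !cR'; first by lia.
  apply: wp_store => /=; rewrite !cR'.
  apply: post => /=; [ | by rewrite sR | | lia | lia].
    by apply: (consts_same (l := [:: 9]) isT _ cR2); apply: same_setr.
  (* Agreement on zero symbols is vacuous; the other three clauses of [level] remain. *)
  split=> //.
  + rewrite (_ : map _ _ = iota 0 n) // -[RHS]map_id.
    apply/eq_in_map => q; rewrite mem_iota => ltq.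
    by rewrite !update_other ?phi //; lia.
  + by move=> _ q ltq; rewrite !update_other ?keys //; lia.
  + move=> t' let_; rewrite starts0.
    case: (eqVneq t' n) => [->|ne_n]; first by rewrite update_same orbT.
    rewrite orbF update_other; last by lia.
    case: (eqVneq t' 0) => [->|ne_0]; first by rewrite addn0 update_same.
    by rewrite update_other ?marks //; lia.
Qed.

End Correctness.

(** * Assembly of the program and the final bounds *)

Theorem theorem11 (k : nat) :
  exists (P : program) (C : nat),
    forall (w sigma n : nat) (s : n.-tuple 'I_sigma)
           (pi : seq 'I_sigma -> rel 'I_sigma) (i : nat),
      sigma <= w ^ k ->
      C * sigma * n < 2 ^ w ->
      primitive s ->
      (forall x : seq 'I_sigma, is_total_order (pi x)) ->
      i < n ->
      nth [::] (ca_matrix pi s) i = s ->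
      exists c : config,
        [/\ halts_with w (ca_bwt pi s) pi P i c,
            time c <= C * (sigma * n ^ 2),
            space c <= C * (sigma * n) &
            [seq memory c j | j <- iota 0 n] = [seq val a | a <- s]].
Proof.
(* 300 exceeds the sum of the costs 18 n, 180 sigma n^2 + 2 and 7 n + 4 of the three phases. It also
   covers the [5 * n + 1] cells of output, phi, T, E and marks, and makes words large enough for all
   addresses. *)
exists (code 0 invert_code ++ [:: IHalt]), 300.
move=> w sigma n s pi i _ big _ tot_pi lti row_i.
have n_gt0 : 0 < n by lia.
(* A symbol exists since [s] is nonempty; it serves as the default value of [nth]. *)
have c0 : 'I_sigma := tnth s (Ordinal lti).
have sigma_gt0 : 0 < sigma by case: c0 => x; case: (sigma).
have le_S : n <= sigma * n by rewrite leq_pmull.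
have le_S' : sigma <= sigma * n by rewrite leq_pmulr.
have le_nn : sigma * n <= sigma * n ^ 2.
  by rewrite leq_mul2l expnS expn1 leq_pmulr ?orbT.
have w_big : 10 * n + sigma < 2 ^ w by rewrite -mulnA in big; lia.
set P := _ ++ _; pose L := ca_bwt pi s.
pose st0 := State (nth 0 [:: n; sigma; i]) (fun=> 0) 0 0.
pose final st := [/\ tm st <= 300 * (sigma * n ^ 2), sp st <= 5 * n + 1
  & forall x, x < n -> cells st x = sym s pi c0 i x].
have run : wp w L pi invert_code final st0.
  apply: wp_then; apply: (@init_spec w sigma n s pi i c0) => //.
  move=> R1 mm1 t1 p1 cR1 R10 lv1 le_t1 lep1.
  apply: wp_then; apply: (@levels_spec w sigma n s pi i c0) => //.
  move=> R2 mm2 t2 p2 cR2 lv2 /= le_t2 lep2.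
  have cE := constsE cR2; have [_ agr _ _] := lv2.
  apply: wp_then; apply: wp_add => /=; rewrite !cE; first by lia.
  (* At level [n] agreement covers whole rows, so extracting [n] symbols from row [i] spells all of
     that row, which is [s]. *)
  apply: (@extract_spec w sigma n s pi i c0 n_gt0 w_big 0 n i) => //=.
  + by apply: (consts_same (l := [:: 16]) isT _ cR2); apply: same_setr.
  + by rewrite cE.
  + by rewrite addn0.
  + exact: level_lt lv2.
  + by move=> q t ltq ltt; apply: agr => //; lia.
  move=> R3 mm3 t3 p3 _ out _ le_t3 lep3; split=> //=; lia.
have placed_P : placed P 0 P by [].
have [st reach [le_t le_p out]] := run P 0 (placed_catl placed_P).
exists (at_pc (0 + size (code 0 invert_code)) st); split=> /=; last first.
- apply: (@eq_from_nth _ 0); rewrite !size_map size_iota ?size_tuple //.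
  move=> x ltx; rewrite (nth_map 0) ?size_iota // (nth_map c0) ?size_tuple //.
  by rewrite nth_iota // add0n out // /sym /row row_i.
- lia.
- exact: le_t.
split; last exact: placed_head (placed_catr (placed_P : placed P 0 (_ ++ _))).
case: reach => t iter_t; exists t; rewrite -iter_t; congr (iter _ _ (Some _)).
by rewrite /init /at_pc /= size_ca_bwt.
Qed.
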